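(* Let $\Delta\ge3$ be an integer, and for a positive integer $d$, $K\in(0,1)$ and an angle $\phi$ let \[f(d,K,\phi)=\max\Big(2\sin(\phi/2),\ \sqrt{1+(1+K)^{-2d}-2\cos(\phi)(1+K)^{-d}}\Big).\] Suppose $k>\Delta$ is an integer and $0<\varepsilon<1$ are such that there exists $K\in(0,1)$ with $\theta:=\arcsin(K)\in\big(0,\frac{\pi}{3(\Delta-1+\varepsilon)}\big)$ satisfying, with $b:=\Delta-d$, \[\frac{(1+\varepsilon)^2(1+K)^d}{\cos((d+b\varepsilon)\theta/2)(k-b)-\varepsilon b(1+K)^d}\le K\quad\text{for } d=0,\dots,\Delta-2,\] \[\frac{(1+\varepsilon)(1+K)^d}{\cos((d+b\varepsilon)\theta/2)(k-b)-\varepsilon b(1+K)^d}\le \frac{K}{f(d,K,(d+b\varepsilon)\theta)}\quad\text{for } d=0,\dots,\Delta-1.\] Let $G=(V,E)$ be any graph of maximum degree at most $\Delta$ and $(w_e)_{e\in E}$ complex weights such that for each $e$ either (i) $|w_e|\le\varepsilon$, or (ii) $|\arg(w_e)|\le\varepsilon\theta$ and $\varepsilon<|w_e|\le1$. Then, with $\mathbf{Z}^W_L(G)$ the restricted partition function with $k$ colours and these weights: (A') For every list $W$ of distinct vertices forming a leaf-independent set and every colour list $L$ with $|L|=|W|$, $\mathbf{Z}^W_L(G)\ne0$. (B') For every list $W=W'u$ of distinct vertices forming a leaf-independent set and any colour lists $L'\ell$, $L'\ell'$ of length $|W|$: (i) the angle between $\mathbf{Z}^{W'u}_{L'\ell}(G)$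 and $\mathbf{Z}^{W'u}_{L'\ell'}(G)$ is at most $\theta$; (ii) $|\mathbf{Z}^{W'u}_{L'\ell}(G)|/|\mathbf{Z}^{W'u}_{L'\ell'}(G)|\le1+K$. (C') For every list $W=W'u$ of distinct vertices with $W'$ a leaf-independent set in $G$, and every colour list $L'$ of length $|W'|$: let $\mathcal{G},\mathcal{N}$ be the sets of good and neutral colours for $u$ with respect to $(G,W',L',\varepsilon)$, $d$ the number of free neighbours of $u$, $b=\Delta-d$, and $m(\ell)$ the number of fixed bad neighbours of $u$ with pre-assigned colour $\ell$. Then (i) $\mathbf{Z}^{W'u}_{L'\ell}(G)\ne0$ for all $\ell\in\mathcal{G}\cup\mathcal{N}$; (ii) for all $\ell,\ell'\in\mathcal{G}\cup\mathcal{N}$ the angle between $\mathbf{Z}^{W'u}_{L'\ell}(G)$ and $\mathbf{Z}^{W'u}_{L'\ell'}(G)$ is at most $(d+b\varepsilon)\theta$; (iii) for all $\ell\in[k]$ and $j\in\mathcal{G}$, $|\mathbf{Z}^{W'u}_{L'\ell}(G)|/|\mathbf{Z}^{W'u}_{L'j}(G)|\le\varepsilon^{m(\ell)}(1+K)^d$.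
   Context: Graphs are simple; $[k]=\{1,\dots,k\}$. For a graph $G=(V,E)$ with complex edge weights $(w_e)$, a list $W=w_1\dots w_m$ of distinct vertices and a list $L=\ell_1\dots\ell_m$ of colours in $[k]$, the restricted partition function is \[\mathbf{Z}^W_L(G)=\sum_{\phi:V\to[k],\ \phi(w_i)=\ell_i\ \forall i}\ \prod_{uv\in E,\ \phi(u)=\phi(v)} w_{uv}.\] $W'u$ and $L'\ell$ denote concatenation of lists. Vertices in $W$ are called fixed (with colour given by $L$); other vertices are free. A set $W\subseteq V$ is leaf-independent if it is an independent set and every vertex in $W$ has degree exactly $1$. Given $\varepsilon>0$, a neighbour $v$ of $u$ is a bad neighbour if $|w_{uv}|\le\varepsilon$. A colour $\ell$ is good for $u$ if no fixed neighbour of $u$ has colour $\ell$; bad if $u$ has at least one fixed bad neighbour coloured $\ell$; neutral if neither good nor bad. Angles between non-zero complex numbers are taken in $[0,\pi]$. *)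

(* Defs.v *)
From Stdlib Require Import Reals Ratan.
From mathcomp Require Import all_boot.
Open Scope R_scope.

Set Implicit Arguments. Unset Strict Implicit. Unset Printing Implicit Defensive.

Record cplx := mkC { re : R ; im : R }.
Definition C0 : cplx := mkC 0 0.
Definition C1 : cplx := mkC 1 0.
Definition Cadd (z w : cplx) : cplx := mkC (re z + re w) (im z + im w).
Definition Cmul (z w : cplx) : cplx :=
  mkC (re z * re w - im z * im w) (re z * im w + im z * re w).
Definition Cnorm (z : cplx) : R := sqrt (re z * re z + im z * im z).

Definition Cangle (z w : cplx) : R :=
  acos ((re z * re w + im z * im w) / (Cnorm z * Cnorm w)).
(* |arg w| for w <> 0, arg taken in (-pi, pi] : the angle between w and 1 *)
Definition Cabs_arg (w : cplx) : R := Cangle w C1.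

(* A simple graph on vertex set 'I_n given by a symmetric irreflexive
   adjacency relation.  Edge weights are given by w u v, read for u < v;
   wt makes this symmetric. *)
Definition simple_graph (n : nat) (adj : rel 'I_n) : Prop :=
  (forall u v, adj u v = adj v u) /\ (forall u, adj u u = false).

Definition deg (n : nat) (adj : rel 'I_n) (u : 'I_n) : nat := #|[set v | adj u v]|.

Definition max_deg_le (n : nat) (adj : rel 'I_n) (D : nat) : Prop :=
  forall u, (deg adj u <= D)%N.

Definition wt (n : nat) (w : 'I_n -> 'I_n -> cplx) (u v : 'I_n) : cplx :=
  if (u < v)%N then w u v else w v u.

(* Colours [k] = {1..k} are represented by 'I_k = {0..k-1}. *)
Definition Zr (n k : nat) (adj : rel 'I_n) (w : 'I_n -> 'I_n -> cplx)
    (W : seq 'I_n) (L : seq 'I_k) : cplx :=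
  \big[Cadd/C0]_(phi : {ffun 'I_n -> 'I_k} |
      [forall i : 'I_(size W), phi (tnth (in_tuple W) i)
                                  == nth (phi (tnth (in_tuple W) i)) L i])
    \big[Cmul/C1]_(p : 'I_n * 'I_n |
        [&& (p.1 < p.2)%N, adj p.1 p.2 & phi p.1 == phi p.2]) w p.1 p.2.

Definition leaf_independent (n : nat) (adj : rel 'I_n) (W : seq 'I_n) : Prop :=
  (forall x y, x \in W -> y \in W -> adj x y = false) /\
  (forall x, x \in W -> deg adj x = 1%N).

Definition fixed_col (n k : nat) (W' : seq 'I_n) (L' : seq 'I_k) (c0 : 'I_k)
    (v : 'I_n) : 'I_k := nth c0 L' (index v W').

Definition fixed_nb (n : nat) (adj : rel 'I_n) (W' : seq 'I_n) (u v : 'I_n) : bool :=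
  adj u v && (v \in W').

Definition good_col (n k : nat) (adj : rel 'I_n) (W' : seq 'I_n) (L' : seq 'I_k)
    (u : 'I_n) (l : 'I_k) : Prop :=
  forall v, fixed_nb adj W' u v -> fixed_col W' L' l v <> l.

Definition bad_col (n k : nat) (adj : rel 'I_n) (w : 'I_n -> 'I_n -> cplx) (eps : R)
    (W' : seq 'I_n) (L' : seq 'I_k) (u : 'I_n) (l : 'I_k) : Prop :=
  exists v, fixed_nb adj W' u v /\ (Cnorm (wt w u v) <= eps) /\
            fixed_col W' L' l v = l.

Definition neutral_col (n k : nat) (adj : rel 'I_n) (w : 'I_n -> 'I_n -> cplx) (eps : R)
    (W' : seq 'I_n) (L' : seq 'I_k) (u : 'I_n) (l : 'I_k) : Prop :=
  ~ good_col adj W' L' u l /\ ~ bad_col adj w eps W' L' u l.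

Definition n_free_nb (n : nat) (adj : rel 'I_n) (W' : seq 'I_n) (u : 'I_n) : nat :=
  #|[set v | adj u v & v \notin W']|.

Definition m_bad (n k : nat) (adj : rel 'I_n) (w : 'I_n -> 'I_n -> cplx) (eps : R)
    (W' : seq 'I_n) (L' : seq 'I_k) (u : 'I_n) (l : 'I_k) : nat :=
  #|[set v | fixed_nb adj W' u v &
        Rle_dec (Cnorm (wt w u v)) eps && (fixed_col W' L' l v == l)]|.

Definition fdK (d : nat) (K phi : R) : R :=
  Rmax (2 * sin (phi / 2))
       (sqrt (1 + / (1 + K) ^ (2 * d) - 2 * cos phi * / (1 + K) ^ d)).

Definition denom (Delta d k : nat) (eps K theta : R) : R :=
  (cos ((INR d + (INR Delta - INR d) * eps) * theta / 2) * (INR k - (INR Delta - INR d))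
   - eps * (INR Delta - INR d) * (1 + K) ^ d).

(* Main.v *)
From HB Require Import structures.
From Stdlib Require Import Reals Lra.
From mathcomp Require Import all_boot.
Require Import Defs.
Set Implicit Arguments. Unset Strict Implicit. Unset Printing Implicit Defensive.
Open Scope R_scope.

(* Freezing a set of vertices that spans no edge turns each fixed vertex into leaves hanging from
   its free neighbours, so Z^W_L is the partition function of the free vertices with a list of
   weighted coloured pendants at each of them. Let a_l be the part of this function in which a
   free vertex u has colour l: removing u gives each of its d free neighbours a pendant of
   colour l, so recolouring these pendants one at a time compares a_l with a_l'. Conversely,
   adding a pendant (x, l) at v changes the sum of the a_j only through (x - 1) a_l. The a_j with j
   not bad lie in a narrow cone, so the sum has modulus at least denom * min |a_j| over good j,
   and the two numerical conditions say exactly that moving the pendant from l to l' perturbs the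
   sum by a relative error of at most K = sin theta. Induction on the number of free vertices
   closes the loop. *)

(** * Real preliminaries *)

HB.instance Definition _ := Monoid.isComLaw.Build R 0 Rplus
  (fun x y z => esym (Rplus_assoc x y z)) Rplus_comm Rplus_0_l.

Lemma INR_leq m n : (m <= n)%N -> INR m <= INR n.
Proof. by move=> /leP; apply: le_INR. Qed.

Lemma mul_self_le_inv x y : 0 <= y -> x * x <= y * y -> x <= y.
Proof. by move=> y0 sqr_le; apply: Rsqr_incr_0_var. Qed.

Lemma Rdiv_le_iff x y z : 0 < y -> x / y <= z <-> x <= z * y.
Proof.
move=> y0; have divK : x = x / y * y by field; lra.
split=> le_z; first by rewrite divK; apply: Rmult_le_compat_r; lra.
by apply: (Rmult_le_reg_r y) => //; rewrite -divK.
Qed.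

Lemma Rdiv_le_div x y z t : 0 < y -> 0 < t -> x / y <= z / t -> x * t <= z * y.
Proof.
move=> y0 t0 /(Rdiv_le_iff _ _ y0) le_x.
have -> : z * y = z / t * y * t by field; lra.
by apply: Rmult_le_compat_r; lra.
Qed.

Lemma pow_le_one x n : 0 <= x <= 1 -> x ^ n <= 1.
Proof. by move=> hx; rewrite -(pow1 n); apply: pow_incr. Qed.

Lemma pow_le_base x n : 0 <= x <= 1 -> (0 < n)%N -> x ^ n <= x.
Proof. by case: n => // n hx _ /=; have := pow_le_one n hx; nra. Qed.

Lemma pow_1p_ge1 x n : 0 <= x -> 1 <= (1 + x) ^ n.
Proof. by move=> x0; apply: pow_R1_Rle; lra. Qed.

Lemma pow_1p_le_exp x n : 0 <= x -> (1 + x) ^ n <= exp (INR n * x).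
Proof.
move=> x0; have := Rpower_pow n _ (exp_pos x); rewrite /Rpower ln_exp => ->.
by apply: pow_incr; have := exp_ineq1_le x; lra.
Qed.

Lemma sumR_const (I : finType) (A : pred I) x :
  \big[Rplus/0]_(i in A) x = INR #|A| * x.
Proof.
rewrite big_const; elim: #|A| => [|n IH]; first by rewrite /=; ring.
by rewrite iterS IH S_INR; ring.
Qed.

Lemma leR_sum (I : finType) (P : pred I) (F G : I -> R) :
  (forall i, P i -> F i <= G i) ->
  \big[Rplus/0]_(i | P i) F i <= \big[Rplus/0]_(i | P i) G i.
Proof.
by move=> FG; apply: big_ind2 FG; [lra | move=> *; lra].
Qed.

Lemma big_setU_disjoint (T : Type) (idx : T) (op : Monoid.com_law idx) (I : finType)
    (A B : {set I}) (F : I -> T) : [disjoint A & B] ->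
  \big[op/idx]_(i in A :|: B) F i
  = op (\big[op/idx]_(i in A) F i) (\big[op/idx]_(i in B) F i).
Proof. by move=> dAB; rewrite -bigU //; apply: eq_bigl => i; rewrite !inE. Qed.

Lemma exists_argmin (I : finType) (P : pred I) (F : I -> R) (i0 : I) :
  P i0 -> exists2 i, P i & forall j, P j -> F i <= F j.
Proof.
move=> P0; suff [i Pi le_i] : exists2 i, P i & forall j, j \in enum I -> P j -> F i <= F j.
  by exists i => // j; apply: le_i; rewrite mem_enum.
elim: (enum I) => [|x s [i Pi le_i]]; first by exists i0.
case: (boolP (P x && Rle_dec (F x) (F i))) => [/andP [Px]|not_le].
  case: Rle_dec => // le_x _; exists x => // j.
  by rewrite inE => /orP [/eqP -> _|js Pj]; [lra | have := le_i j js Pj; lra].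
exists i => // j; rewrite inE => /orP [/eqP -> Px|]; last exact: le_i.
by move: not_le; rewrite Px; case: Rle_dec => //=; lra.
Qed.

(** * Complex numbers *)

Lemma cplx_ext z w : re z = re w -> im z = im w -> z = w.
Proof. by case: z; case: w => /= a b c d -> ->. Qed.

Definition Copp (z : cplx) : cplx := mkC (- re z) (- im z).
Definition Csub (z w : cplx) : cplx := Cadd z (Copp w).

Lemma CaddA : associative Cadd.
Proof. by move=> x y z; apply: cplx_ext => /=; ring. Qed.

Lemma CaddC : commutative Cadd.
Proof. by move=> x y; apply: cplx_ext => /=; ring. Qed.

Lemma Cadd0 : left_id C0 Cadd.
Proof. by move=> x; apply: cplx_ext => /=; ring. Qed.

Lemma CmulA : associative Cmul.
Proof. by move=> x y z; apply: cplx_ext => /=; ring. Qed.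

Lemma CmulC : commutative Cmul.
Proof. by move=> x y; apply: cplx_ext => /=; ring. Qed.

Lemma Cmul1 : left_id C1 Cmul.
Proof. by move=> x; apply: cplx_ext => /=; ring. Qed.

Lemma Cmul0 : left_zero C0 Cmul.
Proof. by move=> x; apply: cplx_ext => /=; ring. Qed.

Lemma CmulDl : left_distributive Cmul Cadd.
Proof. by move=> x y z; apply: cplx_ext => /=; ring. Qed.

Lemma CmulDr : right_distributive Cmul Cadd.
Proof. by move=> x y z; rewrite CmulC CmulDl !(CmulC x). Qed.

Lemma CaddN z : Cadd z (Copp z) = C0.
Proof. by apply: cplx_ext => /=; ring. Qed.

Lemma cplx_ring_theory : ring_theory C0 C1 Cadd Cmul Csub Copp eq.
Proof.
by split; [exact: Cadd0 | exact: CaddC | exact: CaddA | exact: Cmul1 | exact: CmulC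
  | exact: CmulA | exact: CmulDl | | exact: CaddN].
Qed.

Add Ring cplx_ring : cplx_ring_theory.

HB.instance Definition _ := Monoid.isComLaw.Build cplx C0 Cadd CaddA CaddC Cadd0.
HB.instance Definition _ := Monoid.isComLaw.Build cplx C1 Cmul CmulA CmulC Cmul1.
HB.instance Definition _ :=
  Monoid.isMulLaw.Build cplx C0 Cmul Cmul0 (fun x => etrans (CmulC x C0) (Cmul0 x)).
HB.instance Definition _ := Monoid.isAddLaw.Build cplx Cmul Cadd CmulDl CmulDr.

Definition Cdot (z w : cplx) : R := re z * re w + im z * im w.

Lemma CdotDr z x y : Cdot z (Cadd x y) = Cdot z x + Cdot z y.
Proof. by rewrite /Cdot /=; ring. Qed.

Lemma CdotMl q z w : Cdot (Cmul q z) (Cmul q w) = Cdot q q * Cdot z w.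
Proof. by rewrite /Cdot /=; ring. Qed.

Lemma Cnorm_ge0 z : 0 <= Cnorm z.
Proof. exact: sqrt_pos. Qed.

Lemma Cdot_self z : Cdot z z = Cnorm z * Cnorm z.
Proof. by rewrite sqrt_sqrt // /Cdot; nra. Qed.

Lemma Cnorm_eq z x : 0 <= x -> Cdot z z = x * x -> Cnorm z = x.
Proof. by move=> x0 e; rewrite -(sqrt_square x x0) -e. Qed.

Lemma Cnorm0 : Cnorm C0 = 0.
Proof. by apply: Cnorm_eq; rewrite /Cdot /=; lra. Qed.

Lemma Cnorm1 : Cnorm C1 = 1.
Proof. by apply: Cnorm_eq; rewrite /Cdot /=; lra. Qed.

Lemma CnormN z : Cnorm (Copp z) = Cnorm z.
Proof. by apply: Cnorm_eq; rewrite -?Cdot_self /Cdot /=; [exact: Cnorm_ge0 | ring]. Qed.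

Lemma Cnorm_gt0 z : z <> C0 <-> 0 < Cnorm z.
Proof.
split=> [z0|+ e]; last by rewrite e Cnorm0; lra.
case: (Cnorm_ge0 z) => // n0; case: z0.
by have := Cdot_self z; rewrite -n0 /Cdot => e; apply: cplx_ext => /=; nra.
Qed.

Lemma CnormM z w : Cnorm (Cmul z w) = Cnorm z * Cnorm w.
Proof.
apply: Cnorm_eq; first by apply: Rmult_le_pos; exact: Cnorm_ge0.
by rewrite CdotMl !Cdot_self; ring.
Qed.

Lemma Cmul_neq0 z w : z <> C0 -> w <> C0 -> Cmul z w <> C0.
Proof. by rewrite !Cnorm_gt0 CnormM; apply: Rmult_lt_0_compat. Qed.

Lemma Cauchy_Schwarz z w :
  - (Cnorm z * Cnorm w) <= Cdot z w <= Cnorm z * Cnorm w.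
Proof.
have n0 : 0 <= Cnorm z * Cnorm w by apply: Rmult_le_pos; exact: Cnorm_ge0.
suff le_sqr : (Cdot z w)² <= (Cnorm z * Cnorm w)².
  by split; [exact: Rsqr_neg_pos_le_0 | exact: Rsqr_incr_0_var].
have -> : (Cnorm z * Cnorm w)² = Cdot z z * Cdot w w by rewrite !Cdot_self /Rsqr; ring.
by have := Rle_0_sqr (re z * im w - im z * re w); rewrite /Cdot /Rsqr; nra.
Qed.

Lemma Cnorm_sub_sqr z w :
  Cnorm (Csub z w) * Cnorm (Csub z w)
  = Cnorm z * Cnorm z + Cnorm w * Cnorm w - 2 * Cdot z w.
Proof. by rewrite -!Cdot_self /Cdot /=; ring. Qed.

Lemma Cnorm_subC z w : Cnorm (Csub z w) = Cnorm (Csub w z).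
Proof. by rewrite -CnormN; congr Cnorm; ring. Qed.

Lemma Cnorm_sub_le z w : Cnorm (Csub z w) <= Cnorm z + Cnorm w.
Proof.
have [z0 w0] := (Cnorm_ge0 z, Cnorm_ge0 w); apply: mul_self_le_inv; first lra.
by have := Cauchy_Schwarz z w; rewrite Cnorm_sub_sqr; nra.
Qed.

Lemma Cnorm_add_le z w : Cnorm (Cadd z w) <= Cnorm z + Cnorm w.
Proof.
have -> : Cadd z w = Csub z (Copp w) by ring.
by rewrite -(CnormN w); apply: Cnorm_sub_le.
Qed.

Lemma Cnorm_sub_ge z w : Cnorm z - Cnorm w <= Cnorm (Csub z w).
Proof.
have := Cnorm_add_le (Csub z w) w; have -> : Cadd (Csub z w) w = z by ring.
by lra.
Qed.

Lemma Cnorm_sum_le (I : finType) (P : pred I) (a : I -> cplx) :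
  Cnorm (\big[Cadd/C0]_(i | P i) a i) <= \big[Rplus/0]_(i | P i) Cnorm (a i).
Proof.
elim/big_ind2: _ => [|r z s w hz hw|i _]; [by rewrite Cnorm0; lra | | exact: Rle_refl].
by have := Cnorm_add_le z w; lra.
Qed.

(** * Angles *)

Definition polar (r t : R) : cplx := mkC (r * cos t) (r * sin t).

Lemma Cdot_polar r s r' t z :
  Cdot (Cmul (polar r s) z) (Cmul (polar r' t) z) = r * r' * cos (t - s) * Cdot z z.
Proof. by rewrite cos_minus /Cdot /=; ring. Qed.

Lemma Cnorm_polarM r t z : 0 <= r -> Cnorm (Cmul (polar r t) z) = r * Cnorm z.
Proof.
move=> r0; apply: Cnorm_eq; first by have := Cnorm_ge0 z; nra.
by rewrite Cdot_polar Rminus_diag cos_0 Cdot_self; ring.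
Qed.

Lemma cos_Rabs t : cos (Rabs t) = cos t.
Proof. by rewrite /Rabs; case: Rcase_abs => _ //; rewrite cos_neg. Qed.

Lemma acos_cos_Rabs t : Rabs t <= PI -> acos (cos t) = Rabs t.
Proof. by move=> le_PI; rewrite -cos_Rabs acos_cos //; split=> //; apply: Rabs_pos. Qed.

Lemma acos_cos_le t : acos (cos t) <= Rabs t.
Proof.
case: (Rle_dec (Rabs t) PI) => le_PI; first by rewrite acos_cos_Rabs //; lra.
by have := acos_bound (cos t); lra.
Qed.

Lemma CangleC z w : Cangle z w = Cangle w z.
Proof. by congr acos; congr (_ / _); ring. Qed.

Lemma Cangle_bound z w : 0 <= Cangle z w <= PI.
Proof. exact: acos_bound. Qed.

Lemma Cdot_Cangle z w : Cdot z w = cos (Cangle z w) * (Cnorm z * Cnorm w).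
Proof.
have := Cauchy_Schwarz z w.
have : 0 <= Cnorm z * Cnorm w by apply: Rmult_le_pos; exact: Cnorm_ge0.
rewrite /Cangle -/(Cdot z w); set n := Cnorm z * Cnorm w; case=> [n0 | <-].
  move=> [ge_n le_n]; rewrite cos_acos; first by field; lra.
  split; last by apply/Rdiv_le_iff; rewrite // Rmult_1_l.
  by apply: (Rmult_le_reg_r _ _ _ n0); rewrite Rmult_assoc Rinv_l; lra.
by lra.
Qed.

Lemma Cdot_ge_of_Cangle al z w :
  Cangle z w <= al <= PI -> cos al * (Cnorm z * Cnorm w) <= Cdot z w.
Proof.
move=> angle_le; have bound := Cangle_bound z w; rewrite Cdot_Cangle.
apply: Rmult_le_compat_r; first by apply: Rmult_le_pos; exact: Cnorm_ge0.
by apply: cos_decr_1; lra.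
Qed.

Lemma Cangle_le_of_Cdot al z w : z <> C0 -> w <> C0 -> 0 <= al <= PI ->
  cos al * (Cnorm z * Cnorm w) <= Cdot z w -> Cangle z w <= al.
Proof.
rewrite !Cnorm_gt0 Cdot_Cangle => z0 w0 hal.
move=> /(Rmult_le_reg_r _ _ _ (Rmult_lt_0_compat _ _ z0 w0)) cos_le.
by have bound := Cangle_bound z w; apply: cos_decr_0; lra.
Qed.

Lemma Cangle_polar r s r' t z : z <> C0 -> 0 < r -> 0 < r' ->
  Cangle (Cmul (polar r s) z) (Cmul (polar r' t) z) = acos (cos (t - s)).
Proof.
rewrite Cnorm_gt0 => z0 r0 r'0.
rewrite /Cangle -/(Cdot _ _) Cdot_polar !Cnorm_polarM; try lra.
by congr acos; rewrite Cdot_self; field; lra.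
Qed.

Lemma polar10M z : Cmul (polar 1 0) z = z.
Proof. by rewrite /polar cos_0 sin_0; apply: cplx_ext => /=; ring. Qed.

Lemma Cangle_refl z : z <> C0 -> Cangle z z = 0.
Proof.
move=> z0; rewrite -(polar10M z) Cangle_polar ?Rminus_diag ?acos_cos //; try lra.
by have := PI_RGT_0; lra.
Qed.

Definition signed_angle (z w : cplx) : R :=
  if Rle_dec 0 (re z * im w - im z * re w) then Cangle z w else - Cangle z w.

Lemma Rabs_signed_angle z w : Rabs (signed_angle z w) = Cangle z w.
Proof.
have [n0 _] := Cangle_bound z w; rewrite -[RHS](Rabs_pos_eq _ n0).
by rewrite /signed_angle; case: Rle_dec => ? /=; rewrite ?Rabs_Ropp.
Qed.

Lemma sin_signed_angle z w :
  sin (signed_angle z w) * (Cnorm z * Cnorm w) = re z * im w - im z * re w.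
Proof.
have n0 : 0 <= Cnorm z * Cnorm w by apply: Rmult_le_pos; exact: Cnorm_ge0.
have s0 : 0 <= sin (Cangle z w) by have bound := Cangle_bound z w; apply: sin_ge_0; lra.
set det := re z * im w - im z * re w.
have sqr_det : (sin (Cangle z w) * (Cnorm z * Cnorm w))² = det².
  have -> : det² = Cdot z z * Cdot w w - Cdot z w * Cdot z w.
    by rewrite /det /Cdot /Rsqr; ring.
  by rewrite !Rsqr_mult sin2 !Cdot_self Cdot_Cangle /Rsqr; ring.
rewrite /signed_angle -/det; case: Rle_dec => det_sign /=.
  by apply: Rsqr_inj => //; apply: Rmult_le_pos.
rewrite sin_neg Ropp_mult_distr_l_reverse; apply: Ropp_eq_reg; rewrite Ropp_involutive.
by apply: Rsqr_inj; rewrite -?Rsqr_neg //; [exact: Rmult_le_pos | lra].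
Qed.

Lemma polar_signed_angle z w : z <> C0 ->
  w = Cmul (polar (Cnorm w / Cnorm z) (signed_angle z w)) z.
Proof.
move=> /Cnorm_gt0 z0.
have ct : cos (signed_angle z w) * (Cnorm z * Cnorm w) = Cdot z w.
  by rewrite -cos_Rabs Rabs_signed_angle -Cdot_Cangle.
have st := sin_signed_angle z w; have zz := Cdot_self z.
have scale x : Cnorm w / Cnorm z * x = x * (Cnorm z * Cnorm w) / Cdot z z.
  by rewrite zz; field; lra.
have zz0 : Cdot z z <> 0 by rewrite zz; nra.
rewrite /polar !scale ct st; apply: cplx_ext; rewrite /Cdot /= in zz0 *; field; exact: zz0.
Qed.

Lemma Cangle_signed_angle z x y : z <> C0 -> x <> C0 -> y <> C0 ->
  Cangle x y = acos (cos (signed_angle z y - signed_angle z x)).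
Proof.
move=> z0 /Cnorm_gt0 x0 /Cnorm_gt0 y0; have n0 := proj1 (Cnorm_gt0 z) z0.
rewrite {1}(polar_signed_angle x z0) {1}(polar_signed_angle y z0).
by rewrite Cangle_polar //; apply: Rdiv_lt_0_compat.
Qed.

Lemma Cangle_triangle y x z : x <> C0 -> y <> C0 -> z <> C0 ->
  Cangle x z <= Cangle x y + Cangle y z.
Proof.
move=> x0 y0 z0; rewrite (Cangle_signed_angle y0 x0 z0) (CangleC x) -!Rabs_signed_angle.
apply: Rle_trans (acos_cos_le _) _.
by have := Rabs_triang (signed_angle y z) (- signed_angle y x); rewrite Rabs_Ropp /Rminus; lra.
Qed.

Lemma CangleMl q z w : q <> C0 -> Cangle (Cmul q z) (Cmul q w) = Cangle z w.
Proof.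
move=> /Cnorm_gt0 q0; rewrite /Cangle -!/(Cdot _ _) CdotMl Cdot_self !CnormM; congr acos.
have -> : Cnorm q * Cnorm z * (Cnorm q * Cnorm w) = Cnorm q * Cnorm q * (Cnorm z * Cnorm w).
  by ring.
by rewrite Rdiv_mult_l_l //; nra.
Qed.

Lemma CangleM_le p q z w : p <> C0 -> q <> C0 -> z <> C0 -> w <> C0 ->
  Cangle (Cmul p z) (Cmul q w) <= Cangle p q + Cangle z w.
Proof.
move=> p0 q0 z0 w0; rewrite -(CangleMl z w q0) -(CangleMl p q z0).
by rewrite !(CmulC z); apply: Cangle_triangle; apply: Cmul_neq0.
Qed.

Lemma neq0_of_Cnorm_sub K z w :
  K < 1 -> w <> C0 -> Cnorm (Csub z w) <= K * Cnorm w -> z <> C0.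
Proof.
by rewrite !Cnorm_gt0 Cnorm_subC => K1 w0; have := Cnorm_sub_ge w z; nra.
Qed.

Lemma Cangle_le_asin K z w :
  0 <= K < 1 -> w <> C0 -> Cnorm (Csub z w) <= K * Cnorm w -> Cangle z w <= asin K.
Proof.
move=> hK w0 sub_le; have z0 := neq0_of_Cnorm_sub (proj2 hK) w0 sub_le.
apply: Cangle_le_of_Cdot => //.
  have [lb ub] := asin_bound K; have pi := PI_RGT_0; split; last lra.
  by apply: Rnot_lt_le => asin_neg; have := sin_lt_0_var (asin K); rewrite sin_asin; lra.
rewrite cos_asin; last lra.
have s2 : sqrt (1 - K²) * sqrt (1 - K²) = 1 - K * K.
  by rewrite sqrt_sqrt /Rsqr; nra.
have := Cnorm_ge0 (Csub z w); have := Cnorm_sub_sqr z w => sqr ge0.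
have sqr_le : Cnorm (Csub z w) * Cnorm (Csub z w) <= K * Cnorm w * (K * Cnorm w).
  by apply: Rmult_le_compat.
by have := Rle_0_sqr (Cnorm z - sqrt (1 - K²) * Cnorm w); rewrite /Rsqr in s2 *; nra.
Qed.

Definition ratio_within (al rho : R) (z w : cplx) : Prop :=
  [/\ z <> C0, w <> C0, Cangle z w <= al & Cnorm w <= rho * Cnorm z].

Lemma ratio_within_refl z : z <> C0 -> ratio_within 0 1 z z.
Proof. by move=> z0; split; rewrite ?Cangle_refl //; lra. Qed.

Lemma ratio_within_trans y x z al rho al' rho' : 0 <= rho' ->
  ratio_within al rho x y -> ratio_within al' rho' y z -> ratio_within (al + al') (rho' * rho) x z.
Proof.
move=> rho'0 [x0 y0 angle norm] [_ z0 angle' norm']; split=> //.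
  by have := Cangle_triangle x0 y0 z0; lra.
by apply: Rle_trans norm' _; rewrite Rmult_assoc; apply: Rmult_le_compat_l.
Qed.

Lemma ratio_within_of_sub K z w : 0 <= K < 1 -> w <> C0 -> Cnorm (Csub z w) <= K * Cnorm w ->
  ratio_within (asin K) (1 + K) w z.
Proof.
move=> hK w0 sub_le; split=> //; first by apply: neq0_of_Cnorm_sub w0 sub_le; lra.
  by rewrite CangleC; exact: Cangle_le_asin.
by have := Cnorm_sub_ge z w; lra.
Qed.

(** * Chords *)

Lemma chord_sqr_le al z w : Cangle z w <= al <= PI ->
  Cnorm (Csub z w) * Cnorm (Csub z w)
  <= Cnorm z * Cnorm z + Cnorm w * Cnorm w - 2 * cos al * (Cnorm z * Cnorm w).
Proof. by move=> /Cdot_ge_of_Cangle; rewrite Cnorm_sub_sqr; lra. Qed.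

Lemma chord_le_max M z w :
  Cangle z w <= PI / 3 -> Cnorm z <= M -> Cnorm w <= M -> Cnorm (Csub z w) <= M.
Proof.
move=> angle_le; wlog le_zw : z w angle_le / Cnorm z <= Cnorm w.
  move=> wl zM wM; case: (Rle_dec (Cnorm z) (Cnorm w)) => ?; first exact: wl.
  by rewrite Cnorm_subC; apply: wl => //; [rewrite CangleC | lra].
have pi := PI_RGT_0; have := chord_sqr_le (conj angle_le (ltac:(lra) : PI / 3 <= PI)).
rewrite cos_PI3; have z0 := Cnorm_ge0 z => sqr_le _ wM; apply: mul_self_le_inv; nra.
Qed.

Lemma one_sub_cos t : 2 - 2 * cos t = 2 * sin (t / 2) * (2 * sin (t / 2)).
Proof.
have -> : cos t = cos (2 * (t / 2)) by congr cos; field.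
by rewrite cos_2a_sin; ring.
Qed.

(* The left-hand side is convex in [B], hence maximal at [B = A] or at [B = x * A]. *)
Lemma chord_quadratic_le x c F A B : 0 <= A -> x * A <= B <= A ->
  2 - 2 * c <= F -> 1 + x * x - 2 * c * x <= F ->
  A * A + B * B - 2 * c * (A * B) <= F * (A * A).
Proof.
move=> A0 hB F_one F_x.
apply: (Rle_trans _ ((1 - x) * (A * A) + (1 + x - 2 * c) * (A * B))); first nra.
case: (Rle_dec 0 (1 + x - 2 * c)) => slope.
  have : (1 + x - 2 * c) * (A * B) <= (1 + x - 2 * c) * (A * A).
    by apply: Rmult_le_compat_l => //; nra.
  by have := Rmult_le_compat_r (A * A) _ _ (ltac:(nra)) F_one; lra.
have : (2 * c - 1 - x) * (x * (A * A)) <= (2 * c - 1 - x) * (A * B).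
  by apply: Rmult_le_compat_l; nra.
by have := Rmult_le_compat_r (A * A) _ _ (ltac:(nra)) F_x; lra.
Qed.

Lemma fdK_sin_le d K phi : 2 * sin (phi / 2) <= fdK d K phi.
Proof. exact: Rmax_l. Qed.

Lemma fdK_sqr_ge d K phi : 0 <= fdK d K phi ->
  1 + / (1 + K) ^ d * / (1 + K) ^ d - 2 * cos phi * / (1 + K) ^ d
  <= fdK d K phi * fdK d K phi.
Proof.
have -> : / (1 + K) ^ d * / (1 + K) ^ d = / (1 + K) ^ (2 * d).
  by rewrite mulnC pow_mult -Rinv_mult /= Rmult_1_r.
set X := 1 + _ - _ => f0.
have sqrt_le : sqrt X <= fdK d K phi by exact: Rmax_r.
case: (Rle_dec 0 X) => X0; last by nra.
by rewrite -(sqrt_sqrt X X0); apply: Rmult_le_compat; try exact: sqrt_pos.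
Qed.

Lemma chord_le_fdK d K phi M z w :
  0 <= K -> Cangle z w <= phi <= PI -> Cnorm z <= M -> Cnorm w <= M ->
  Cnorm z <= (1 + K) ^ d * Cnorm w -> Cnorm w <= (1 + K) ^ d * Cnorm z ->
  Cnorm (Csub z w) <= fdK d K phi * M.
Proof.
move=> K0 angle_le; wlog le_wz : z w angle_le / Cnorm w <= Cnorm z.
  move=> wl zM wM zw wz; case: (Rle_dec (Cnorm w) (Cnorm z)) => ?; first exact: wl.
  by rewrite Cnorm_subC; apply: wl => //; [rewrite CangleC | lra].
move=> zM _ zw _; have z0 := Cnorm_ge0 z.
have f0 : 0 <= fdK d K phi.
  apply: Rle_trans (fdK_sin_le d K phi); have bound := Cangle_bound z w.
  by apply: Rmult_le_pos; [lra | apply: sin_ge_0; lra].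
apply: Rle_trans (_ : fdK d K phi * Cnorm z <= _); last by apply: Rmult_le_compat_l.
apply: mul_self_le_inv; first exact: Rmult_le_pos.
apply: Rle_trans (chord_sqr_le angle_le) _.
have -> : fdK d K phi * Cnorm z * (fdK d K phi * Cnorm z)
  = fdK d K phi * fdK d K phi * (Cnorm z * Cnorm z) by ring.
apply: (@chord_quadratic_le (/ (1 + K) ^ d)) => //; last exact: fdK_sqr_ge.
  split=> //; rewrite Rmult_comm -/(Rdiv _ _).
  by apply/Rdiv_le_iff; [have := pow_1p_ge1 d K0; lra | rewrite Rmult_comm].
have s0 := fdK_sin_le d K phi; have bound := Cangle_bound z w.
have := sin_ge_0 (phi / 2); rewrite one_sub_cos => s1.
by apply: Rmult_le_compat; lra.
Qed.

(** * Sums in a cone *)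

(* The difference is at most [2 * al] and agrees with the angle from [x] to [y] up to sign and
   modulo [2 * PI]; the wrapped-around value [2 * PI - al] would exceed [2 * al]. *)
Lemma signed_angle_sub_le al z x y : al < 2 * PI / 3 -> z <> C0 -> x <> C0 -> y <> C0 ->
  Cangle z x <= al -> Cangle z y <= al -> Cangle x y <= al ->
  signed_angle z y - signed_angle z x <= al.
Proof.
move=> al_lt z0 x0 y0; rewrite (Cangle_signed_angle z0 x0 y0) -!Rabs_signed_angle.
set s := signed_angle z x; set t := signed_angle z y => s_le t_le acos_le.
have t_bound := Rle_abs t; have s_bound := Rle_abs (- s); rewrite Rabs_Ropp in s_bound.
case: (Rle_dec (t - s) PI) => [le_PI | gt_PI].
  case: (Rle_dec 0 (t - s)) => [ge0|]; last by have := Rabs_pos s; lra.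
  by rewrite acos_cos in acos_le.
have := acos_cos_Rabs (t := 2 * PI - (t - s)).
have -> : cos (2 * PI - (t - s)) = cos (t - s).
  by rewrite -[RHS]cos_neg -[RHS](cos_period _ 1); congr cos; rewrite /=; ring.
by rewrite Rabs_pos_eq; lra.
Qed.

(* Measured from a fixed member, the bisector of the two extreme arguments is within [al / 2] of
   every member. *)
Lemma cone_bisector (I : finType) (A : pred I) (a : I -> cplx) (al : R) :
  0 <= al < 2 * PI / 3 -> (forall i, A i -> a i <> C0) ->
  (forall i j, A i -> A j -> Cangle (a i) (a j) <= al) ->
  exists2 e, Cnorm e = 1 & forall i, A i -> cos (al / 2) * Cnorm (a i) <= Cdot e (a i).
Proof.
move=> hal a_neq0 angle_le; case: (pickP A) => [o Ao|none]; last first.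
  by exists C1; [exact: Cnorm1 | move=> i; rewrite none].
have o0 := a_neq0 o Ao; have n0 := proj1 (Cnorm_gt0 _) o0.
pose t i := signed_angle (a o) (a i).
have [lo Alo lo_le] := exists_argmin t Ao.
have [hi Ahi hi_ge] := exists_argmin (fun i => - t i) Ao.
have width : t hi - t lo <= al by apply: signed_angle_sub_le; auto; lra.
pose c := (t lo + t hi) / 2.
have inv0 := Rinv_0_lt_compat _ n0.
exists (Cmul (polar (/ Cnorm (a o)) c) (a o)).
  by rewrite Cnorm_polarM; [field; lra | lra].
move=> i Ai; rewrite {2}(polar_signed_angle (a i) o0) Cdot_polar -/(t i) Cdot_self.
have -> : / Cnorm (a o) * (Cnorm (a i) / Cnorm (a o)) * cos (t i - c)
    * (Cnorm (a o) * Cnorm (a o)) = cos (t i - c) * Cnorm (a i) by field; lra.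
apply: Rmult_le_compat_r; first exact: Cnorm_ge0.
have near_c : Rabs (t i - c) <= al / 2.
  by apply: Rabs_le; have := lo_le i Ai; have := hi_ge i Ai; rewrite /c; lra.
by rewrite -(cos_Rabs (t i - c)); apply: cos_decr_1; have := Rabs_pos (t i - c); lra.
Qed.

Lemma Cnorm_sum_ge_cone (I : finType) (A : pred I) (a : I -> cplx) (al : R) :
  0 <= al < 2 * PI / 3 -> (forall i, A i -> a i <> C0) ->
  (forall i j, A i -> A j -> Cangle (a i) (a j) <= al) ->
  cos (al / 2) * \big[Rplus/0]_(i | A i) Cnorm (a i)
  <= Cnorm (\big[Cadd/C0]_(i | A i) a i).
Proof.
move=> hal a_neq0 angle_le; have [e e1 e_le] := cone_bisector hal a_neq0 angle_le.
have [_ cs] := Cauchy_Schwarz e (\big[Cadd/C0]_(i | A i) a i).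
apply: Rle_trans (_ : _ <= Cdot e (\big[Cadd/C0]_(i | A i) a i)) _; last by rewrite e1 in cs; lra.
rewrite (big_morph _ (CdotDr e) (_ : Cdot e C0 = 0)); last by rewrite /Cdot /=; ring.
rewrite (big_morph (Rmult (cos (al / 2))) (fun x y => Rmult_plus_distr_l _ x y) (Rmult_0_r _)).
exact: leR_sum.
Qed.

Lemma Cnorm_sum_ge_cone_defect (I : finType) (G B : pred I) (a : I -> cplx) (al m y : R) :
  0 <= al < 2 * PI / 3 -> (forall i, G i -> ~~ B i) ->
  (forall i, ~~ B i -> a i <> C0) ->
  (forall i j, ~~ B i -> ~~ B j -> Cangle (a i) (a j) <= al) ->
  (forall i, G i -> m <= Cnorm (a i)) -> (forall i, B i -> Cnorm (a i) <= y) ->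
  cos (al / 2) * (INR #|G| * m) - INR #|B| * y <= Cnorm (\big[Cadd/C0]_i a i).
Proof.
move=> hal GB a_neq0 angle_le m_le le_y.
rewrite (bigID B) /= CaddC.
set out := \big[Cadd/C0]_(i | ~~ B i) a i; set inn := \big[Cadd/C0]_(i | B i) a i.
have -> : Cadd out inn = Csub out (Copp inn) by ring.
apply: Rle_trans (Cnorm_sub_ge _ _); rewrite CnormN.
have out_ge := Cnorm_sum_ge_cone hal a_neq0 angle_le.
have inn_le : Cnorm inn <= INR #|B| * y.
  by apply: Rle_trans (Cnorm_sum_le _ _) _; rewrite -sumR_const; apply: leR_sum.
have G_le : INR #|G| * m <= \big[Rplus/0]_(i | ~~ B i) Cnorm (a i).
  rewrite -sumR_const big_mkcond [X in _ <= X]big_mkcond; apply: leR_sum => i _.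
  rewrite unfold_in; case: (boolP (G i)) => [Gi|_]; first by rewrite GB //; apply: m_le.
  by case: ifP => _; [exact: Cnorm_ge0 | lra].
have c0 : 0 <= cos (al / 2) by apply: cos_ge_0; lra.
by have := Rmult_le_compat_l _ _ _ c0 G_le; rewrite -/out in out_ge; lra.
Qed.

(** * Numerical estimates *)

Lemma PI_lt_33_10 : PI < 33 / 10.
Proof. by have [_] := PI_2_3_7_ineq 0; rewrite /tg_alt /PI_2_3_7_tg /Ratan_seq /=; lra. Qed.

Lemma exp_11_10_lt : exp (11 / 10) < 17 / 5.
Proof.
have -> : 11 / 10 = 1 + 1 / 10 by field.
rewrite exp_plus; have e1 := exp_le_3; have e0 := exp_pos (1 / 10).
have : exp (1 / 10) * exp (- (1 / 10)) = 1 by rewrite exp_Ropp Rinv_r; lra.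
by have := exp_ineq1_le (- (1 / 10)); nra.
Qed.

(* [11 / 10] is an upper bound for [PI / 3] and [43 / 50] a lower bound for [cos (PI / 6)]. *)
Lemma pow_1p_lt n x : (2 <= n)%N -> 0 <= x -> INR n * x <= 11 / 10 ->
  (1 + x) ^ n < 43 / 50 * (INR n + 1).
Proof.
rewrite leq_eqVlt => /orP [/eqP <- | n3] x0 nx; first by move: nx => /=; nra.
apply: Rle_lt_trans (pow_1p_le_exp n x0) _; have {n3} := INR_leq n3.
have : exp (INR n * x) <= exp (11 / 10) by case: nx => [/exp_increasing|->]; lra.
by rewrite /=; have := exp_11_10_lt; lra.
Qed.

Lemma cos_gt_43_50 t : 0 <= t <= PI / 6 -> 43 / 50 < cos t.
Proof.
move=> ht; have pi := PI_RGT_0; apply: (Rlt_le_trans _ (cos (PI / 6))).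
  by rewrite cos_PI6; have := sqrt_pos 3; have := sqrt_sqrt 3 (ltac:(lra)); nra.
by apply: cos_decr_1; lra.
Qed.

Lemma two_sin_half_ge t : 0 <= t <= PI -> t - t * t * t / 24 <= 2 * sin (t / 2).
Proof.
move=> ht; have [+ _] := sin_bound (t / 2) 0 (ltac:(lra)) (ltac:(lra)).
by rewrite /sin_approx /sin_term /=; lra.
Qed.

Lemma two_sin_half_mul_ge q t : 0 <= t <= 2 -> 1 + t <= q ->
  t * (q + 1) <= 2 * q * (2 * sin (t / 2)).
Proof.
move=> ht hq; have pi2 := PI2_3_2.
have := two_sin_half_ge (t := t) (ltac:(lra)) => sin_ge.
apply: (Rle_trans _ (2 * q * (t - t * t * t / 24))); last by apply: Rmult_le_compat_l; lra.
have : 1 <= q * (1 - t * t / 12).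
  apply: (Rle_trans _ ((1 + t) * (1 - t * t / 12))); first by nra.
  by apply: Rmult_le_compat_r; nra.
by nra.
Qed.

(** * Partition functions with pendants *)

Section PartitionFunction.

Variables (n k : nat) (adj : rel 'I_n) (w : 'I_n -> 'I_n -> cplx).
Hypothesis adj_simple : simple_graph adj.

Definition pendant : Type := (cplx * 'I_k)%type.

Implicit Types (S A B : {set 'I_n}) (u v x y : 'I_n) (phi psi : {ffun 'I_n -> 'I_k})
  (col : 'I_n -> 'I_k) (l : 'I_k) (q : pendant) (s : seq pendant) (c : 'I_n -> seq pendant).

Definition pend_factor q l : cplx := if q.2 == l then q.1 else C1.
Definition pend_weight s l : cplx := \big[Cmul/C1]_(q <- s) pend_factor q l.
Definition good_colour s l : bool := l \notin map snd s.

Definition oriented_weight phi x y : cplx :=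
  if [&& (x < y)%N, adj x y & phi x == phi y] then w x y else C1.
Definition interaction phi x y : cplx :=
  if adj x y && (phi x == phi y) then wt w x y else C1.
Definition edges_weight A phi : cplx :=
  \big[Cmul/C1]_(x in A) \big[Cmul/C1]_(y in A) oriented_weight phi x y.
Definition config_weight S c phi : cplx :=
  Cmul (edges_weight S phi) (\big[Cmul/C1]_(v in S) pend_weight (c v) (phi v)).
Definition agree_off S psi phi : bool := [forall v, (v \in S) || (phi v == psi v)].

(* The partition function of the graph induced on the free vertices [S], where a pair
   [(x, l)] in [c v] stands for a leaf of colour [l] hanging from [v] by an edge of weight [x].
   Vertices outside [S] keep their colour in [psi]. *)
Definition Zpend S psi c : cplx :=
  \big[Cadd/C0]_(phi | agree_off S psi phi) config_weight S c phi.
Definition Zpend_at S psi c u l : cplx :=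
  \big[Cadd/C0]_(phi | agree_off S psi phi && (phi u == l)) config_weight S c phi.

Definition nbrs S u : {set 'I_n} := [set v in S | adj u v].
Definition add_pend c v q : 'I_n -> seq pendant :=
  fun y => if y == v then q :: c y else c y.
Definition add_leaves u A c col : 'I_n -> seq pendant :=
  fun y => if y \in A then (wt w u y, col y) :: c y else c y.

Lemma pend_weight_good_colour s l : good_colour s l -> pend_weight s l = C1.
Proof.
rewrite /good_colour /pend_weight; elim: s => [|q s IH]; first by rewrite big_nil.
rewrite /= inE negb_or big_cons => /andP [lq /IH ->].
by rewrite /pend_factor eq_sym (negbTE lq) Cmul1.
Qed.

Lemma card_good_colour_ge s : (k - size s <= #|good_colour s|)%N.
Proof.
rewrite leq_subLR -{1}(card_ord k) -(cardC (mem (map snd s))).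
by apply: leq_add; [rewrite -(size_map snd); exact: card_size | exact/eq_leq/eq_card].
Qed.

Lemma adj_sym x y : adj x y = adj y x.
Proof. by case: adj_simple. Qed.

Lemma adj_irr x : adj x x = false.
Proof. by case: adj_simple. Qed.

Lemma oriented_weightM phi x y :
  Cmul (oriented_weight phi x y) (oriented_weight phi y x) = interaction phi x y.
Proof.
rewrite /oriented_weight /interaction /wt (adj_sym y) (eq_sym (phi y)).
case: ltngtP => [_|_|/val_inj ->] /=; rewrite ?adj_irr /=; [| |ring]; by case: ifP => _; ring.
Qed.

Lemma edges_weightU A B phi : [disjoint A & B] ->
  edges_weight (A :|: B) phi = Cmul (Cmul (edges_weight A phi) (edges_weight B phi))
    (\big[Cmul/C1]_(x in A) \big[Cmul/C1]_(y in B) interaction phi x y).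
Proof.
move=> dAB.
have -> : \big[Cmul/C1]_(x in A) \big[Cmul/C1]_(y in B) interaction phi x y
    = Cmul (\big[Cmul/C1]_(x in A) \big[Cmul/C1]_(y in B) oriented_weight phi x y)
           (\big[Cmul/C1]_(x in B) \big[Cmul/C1]_(y in A) oriented_weight phi x y).
  rewrite [X in _ = Cmul _ X]exchange_big -big_split /=; apply: eq_bigr => x _.
  by rewrite -big_split /=; apply: eq_bigr => y _; rewrite oriented_weightM.
have split_row C : \big[Cmul/C1]_(x in C) \big[Cmul/C1]_(y in A :|: B) oriented_weight phi x y
    = Cmul (\big[Cmul/C1]_(x in C) \big[Cmul/C1]_(y in A) oriented_weight phi x y)
           (\big[Cmul/C1]_(x in C) \big[Cmul/C1]_(y in B) oriented_weight phi x y).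
  by rewrite -big_split; apply: eq_bigr => x _; rewrite big_setU_disjoint.
rewrite /edges_weight big_setU_disjoint // !split_row [RHS]Monoid.mulmACA.
by congr Cmul; exact: CmulC.
Qed.

Lemma edges_weight1 u phi : edges_weight [set u] phi = C1.
Proof. by rewrite /edges_weight !big_set1 /oriented_weight ltnn. Qed.

Lemma eq_config_weight S c c' phi phi' :
  {in S, phi =1 phi'} -> {in S, c =1 c'} -> config_weight S c phi = config_weight S c' phi'.
Proof.
move=> e_phi e_c; congr Cmul; last by apply: eq_bigr => v vS; rewrite e_phi ?e_c.
by apply: eq_bigr => x xS; apply: eq_bigr => y yS; rewrite /oriented_weight !e_phi.
Qed.

Lemma eq_Zpend S psi c c' : {in S, c =1 c'} -> Zpend S psi c = Zpend S psi c'.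
Proof. by move=> e_c; apply: eq_bigr => phi _; apply: eq_config_weight. Qed.

Lemma Zpend_frozen_irrelevant S psi psi' c : Zpend S psi c = Zpend S psi' c.
Proof.
pose refreeze psi phi : {ffun 'I_n -> 'I_k} := [ffun v => if v \in S then phi v else psi v].
have refreezeK psi1 psi2 phi :
    agree_off S psi1 phi -> refreeze psi1 (refreeze psi2 phi) = phi.
  move=> /forallP agree; apply/ffunP => v; rewrite !ffunE; case: ifP => [->//|vS].
  by have := agree v; rewrite vS => /eqP.
have refreeze_agree psi1 phi : agree_off S psi1 (refreeze psi1 phi).
  by apply/forallP => v; rewrite ffunE; case: (v \in S) => /=.
rewrite /Zpend (reindex_onto (refreeze psi) (refreeze psi')) => [|phi /refreezeK //].
rewrite (eq_bigl (agree_off S psi')) => [|phi].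
  by apply: eq_bigr => phi _; apply: eq_config_weight => // v vS; rewrite ffunE vS.
by rewrite refreeze_agree; apply/eqP/idP => [<- | /refreezeK].
Qed.

Lemma Zpend_sum S psi c u : Zpend S psi c = \big[Cadd/C0]_l Zpend_at S psi c u l.
Proof. exact: (partition_big (fun phi => phi u) predT). Qed.

Lemma config_weightD1 S c u phi : u \in S ->
  config_weight S c phi = Cmul (pend_weight (c u) (phi u))
    (config_weight (S :\ u) (add_leaves u (nbrs S u) c (fun=> phi u)) phi).
Proof.
move=> uS; have du : [disjoint [set u] & S :\ u] by rewrite disjoints1 !inE eqxx.
have leaves : \big[Cmul/C1]_(v in S :\ u)
      pend_weight (add_leaves u (nbrs S u) c (fun=> phi u) v) (phi v)
    = Cmul (\big[Cmul/C1]_(v in S :\ u) interaction phi u v)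
           (\big[Cmul/C1]_(v in S :\ u) pend_weight (c v) (phi v)).
  rewrite -big_split /=; apply: eq_bigr => v; rewrite !inE => /andP [_ vS].
  rewrite /add_leaves inE vS /interaction; case: (adj u v) => /=; last by ring.
  by rewrite /pend_weight big_cons.
rewrite /config_weight leaves -{1}(setD1K uS) edges_weightU // edges_weight1 big_set1.
rewrite (big_setD1 u uS) /= Cmul1 [RHS]CmulC [Cmul (pend_weight _ _) _]CmulC.
by rewrite -!CmulA.
Qed.

Lemma Zpend_atE S psi c u l : u \in S ->
  Zpend_at S psi c u l = Cmul (pend_weight (c u) l)
    (Zpend (S :\ u) psi (add_leaves u (nbrs S u) c (fun=> l))).
Proof.
move=> uS; pose psi' : {ffun 'I_n -> 'I_k} := [ffun v => if v == u then l else psi v].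
rewrite (Zpend_frozen_irrelevant _ psi psi') [RHS]big_distrr /=.
apply: eq_big => [phi|phi /andP [_ /eqP <-]]; last exact: config_weightD1.
apply/andP/forallP => [[/forallP agree /eqP phi_u] v|agree].
  by rewrite !inE ffunE; case: eqP => [->|_] /=; [rewrite phi_u | exact: agree].
split; last by have := agree u; rewrite !inE ffunE eqxx.
apply/forallP => v; have := agree v; rewrite !inE ffunE.
by case: eqP => [->|_] //=; rewrite uS.
Qed.

Lemma Zpend_at_add_pend S psi c v q l : v \in S ->
  Zpend_at S psi (add_pend c v q) v l = Cmul (pend_factor q l) (Zpend_at S psi c v l).
Proof.
move=> vS; rewrite !Zpend_atE // CmulA; congr Cmul.
  by rewrite /add_pend eqxx /pend_weight big_cons.
apply: eq_Zpend => y; rewrite !inE => /andP [yv _].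
by rewrite /add_leaves /add_pend (negbTE yv).
Qed.

Lemma Zpend_add_pend S psi c v a l : v \in S ->
  Zpend S psi (add_pend c v (a, l))
  = Cadd (Zpend S psi c) (Cmul (Csub a C1) (Zpend_at S psi c v l)).
Proof.
move=> vS; rewrite !(Zpend_sum S psi _ v) (bigD1 l) //= [in RHS](bigD1 l) //=.
under eq_bigr => j jl do rewrite Zpend_at_add_pend // /pend_factor /= eq_sym (negbTE jl) Cmul1.
by rewrite Zpend_at_add_pend // /pend_factor eqxx /=; ring.
Qed.

Lemma Zpend_sub_add_pend S psi c v a l l' : v \in S ->
  Csub (Zpend S psi (add_pend c v (a, l))) (Zpend S psi (add_pend c v (a, l')))
  = Cmul (Csub a C1) (Csub (Zpend_at S psi c v l) (Zpend_at S psi c v l')).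
Proof. by move=> vS; rewrite !Zpend_add_pend //; ring. Qed.

Lemma Zpend_set0 psi c : Zpend set0 psi c = C1.
Proof.
rewrite /Zpend (big_pred1 psi) => [|phi].
  by rewrite /config_weight /edges_weight !big_set0; ring.
apply/forallP/eqP => [agree|-> v]; last by rewrite eqxx orbT.
by apply/ffunP => v; have := agree v; rewrite inE => /eqP.
Qed.

Lemma card_nbrsD1 S u v : u \in S -> #|nbrs S v| = (#|nbrs (S :\ u) v| + adj u v)%N.
Proof.
move=> uS; rewrite (cardsD1 u) !inE uS /= adj_sym addnC; congr addn.
by apply: eq_card => y; rewrite !inE andbA.
Qed.

(** * Fixed vertices as pendants *)

Variable col0 : 'I_k.
Implicit Types (W : seq 'I_n) (L : seq 'I_k).

Definition fixed_colouring W L : {ffun 'I_n -> 'I_k} := [ffun v => fixed_col W L col0 v].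
Definition free_set W : {set 'I_n} := [set v | v \notin W].
Definition fixed_pend W L v : seq pendant :=
  [seq (wt w v x, fixed_col W L col0 x) | x <- W & adj v x].
Definition independent W : Prop := forall x y, x \in W -> y \in W -> adj x y = false.

Lemma independent_rcons W u : independent (rcons W u) -> independent W.
Proof. by move=> indep x y xW yW; apply: indep; rewrite mem_rcons inE ?xW ?yW orbT. Qed.

Lemma fixed_colE W L l l' x : size L = size W -> x \in W ->
  fixed_col W L l x = fixed_col W L l' x.
Proof. by move=> sL xW; apply: set_nth_default; rewrite sL index_mem. Qed.

Lemma Zr_constraintE W L phi : uniq W -> size L = size W ->
  [forall i : 'I_(size W), phi (tnth (in_tuple W) i) == nth (phi (tnth (in_tuple W) i)) L i]
  = agree_off (free_set W) (fixed_colouring W L) phi.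
Proof.
move=> uW sL; apply/forallP/forallP => [agree v|agree i].
  rewrite inE ffunE; case: (boolP (v \in W)) => //= vW.
  have iW : (index v W < size W)%N by rewrite index_mem.
  have := agree (Ordinal iW); rewrite (tnth_nth v) /= nth_index //.
  by rewrite (set_nth_default col0) // sL.
rewrite (tnth_nth (tnth (in_tuple W) i)) /=; set v := nth _ _ _.
have := agree v; rewrite inE mem_nth //= ffunE => /eqP ->.
by rewrite /fixed_col index_uniq // (set_nth_default col0) // sL.
Qed.

Lemma edges_weight_setT phi : edges_weight setT phi
  = \big[Cmul/C1]_(p : 'I_n * 'I_n | [&& (p.1 < p.2)%N, adj p.1 p.2 & phi p.1 == phi p.2])
      w p.1 p.2.
Proof.
rewrite [RHS]big_mkcond -(pair_bigA _ (oriented_weight phi)) /=.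
by apply: eq_big => [x|x _]; [rewrite inE | apply: eq_bigl => y; rewrite inE].
Qed.

Lemma edges_weight_fixed_pend W L phi : uniq W -> independent W ->
  agree_off (free_set W) (fixed_colouring W L) phi ->
  edges_weight setT phi = config_weight (free_set W) (fixed_pend W L) phi.
Proof.
move=> uW indep /forallP agree.
have -> : setT = free_set W :|: [set x in W] by apply/setP => x; rewrite !inE orNb.
rewrite edges_weightU; last first.
  by rewrite -setI_eq0; apply/eqP/setP => x; rewrite !inE andNb.
have -> : edges_weight [set x in W] phi = C1.
  apply: big1 => x; rewrite inE => xW; apply: big1 => y; rewrite inE => yW.
  by rewrite /oriented_weight indep // andbF.
rewrite (CmulC _ C1) Cmul1; congr Cmul; apply: eq_bigr => v vS.
rewrite /pend_weight big_map big_filter [RHS]big_mkcond (big_uniq _ uW) /=.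
apply: eq_big => [x|x]; rewrite inE // => xW.
have : phi x == fixed_colouring W L x by have := agree x; rewrite inE xW.
by rewrite ffunE /interaction /pend_factor /= => /eqP ->; rewrite eq_sym; case: (adj v x).
Qed.

Lemma Zr_Zpend W L : uniq W -> independent W -> size L = size W ->
  Zr adj w W L = Zpend (free_set W) (fixed_colouring W L) (fixed_pend W L).
Proof.
move=> uW indep sL; apply: eq_big => [phi|phi]; rewrite Zr_constraintE // => agree.
by rewrite -edges_weight_setT; exact: edges_weight_fixed_pend.
Qed.

Lemma agree_off_rcons W L u l phi : u \notin W -> size L = size W ->
  agree_off (free_set (rcons W u)) (fixed_colouring (rcons W u) (rcons L l)) phi
  = agree_off (free_set W) (fixed_colouring W L) phi && (phi u == l).
Proof.
move=> uW sL; have fixed_colouring_u : fixed_colouring (rcons W u) (rcons L l) u = l.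
  rewrite ffunE /fixed_col -(cats1 W) index_cat (negbTE uW) /= eqxx addn0.
  by rewrite nth_rcons sL ltnn eqxx.
have fixed_colouring_W x :
    x \in W -> fixed_colouring (rcons W u) (rcons L l) x = fixed_colouring W L x.
  move=> xW; rewrite !ffunE /fixed_col -(cats1 W) index_cat xW.
  by rewrite nth_rcons sL index_mem xW.
apply/forallP/andP => [agree|[/forallP agree /eqP phi_u] v].
  split; last by have := agree u; rewrite inE mem_rcons mem_head /= fixed_colouring_u.
  apply/forallP => v; rewrite inE; case: (boolP (v \in W)) => //= vW.
  by have := agree v; rewrite inE mem_rcons inE vW orbT /= fixed_colouring_W.
rewrite inE mem_rcons inE; case: eqP => [->|_] /=; first by rewrite fixed_colouring_u phi_u.
by have := agree v; rewrite inE; case: (boolP (v \in W)) => //= vW; rewrite fixed_colouring_W.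
Qed.

Lemma Zr_rcons W L u l : uniq (rcons W u) -> independent W -> size L = size W ->
  Zr adj w (rcons W u) (rcons L l)
  = Zpend_at (free_set W) (fixed_colouring W L) (fixed_pend W L) u l.
Proof.
move=> uWu indep sL; have := uWu; rewrite rcons_uniq => /andP [uW' uW].
apply: eq_big => [phi|phi]; rewrite Zr_constraintE ?size_rcons ?sL // agree_off_rcons //.
by case/andP => agree _; rewrite -edges_weight_setT; exact: edges_weight_fixed_pend.
Qed.

Lemma size_fixed_pend W L v : uniq W ->
  (#|nbrs (free_set W) v| + size (fixed_pend W L v) = deg adj v)%N.
Proof.
move=> uW; rewrite /deg -[RHS](cardsID (free_set W)) size_map; congr addn.
  by apply: eq_card => x; rewrite !inE andbC.
rewrite -(card_uniqP (filter_uniq (adj v) uW)); apply: eq_card => x.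
by rewrite !inE mem_filter negbK andbC.
Qed.

Lemma card_nbrs_free_set W u : #|nbrs (free_set W) u| = n_free_nb adj W u.
Proof. by apply: eq_card => x; rewrite !inE andbC. Qed.

Lemma good_colour_fixed_pend W L u l : size L = size W ->
  good_col adj W L u l -> good_colour (fixed_pend W L u) l.
Proof.
move=> sL good_l; rewrite /good_colour -map_comp; apply/mapP => -[x].
rewrite mem_filter => /andP [ax xW] /= l_x; apply: (good_l x); first by rewrite /fixed_nb ax.
by rewrite (fixed_colE _ col0).
Qed.

(** * The numerical conditions *)

Section ZeroFreeness.

Variables (Delta : nat) (eps K : R).
Local Notation theta := (asin K).
Local Notation den d := (denom Delta d k eps K theta).

Hypotheses (Delta3 : (3 <= Delta)%N) (lt_Delta_k : (Delta < k)%N).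
Hypotheses (eps01 : 0 < eps < 1) (K01 : 0 < K < 1).
Hypothesis theta_bounds : 0 < theta < PI / (3 * (INR Delta - 1 + eps)).

Definition cone_angle (d : nat) : R := (INR d + (INR Delta - INR d) * eps) * theta.

Lemma Delta_gt0 : (0 < Delta)%N.
Proof. exact: leq_trans Delta3. Qed.

Lemma Delta_ge3 : 3 <= INR Delta.
Proof. by have := INR_leq Delta3; rewrite /=; lra. Qed.

Lemma INR_Delta_pred : INR (Delta - 1) = INR Delta - 1.
Proof. by rewrite minus_INR //; exact/leP/Delta_gt0. Qed.

Lemma K_le_theta : K <= theta.
Proof.
by rewrite -[X in X <= _](sin_asin K); [apply/Rlt_le/sin_lt_x; lra | lra].
Qed.

Lemma cone_angle_le d d' : (d <= d')%N -> cone_angle d <= cone_angle d'.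
Proof. by move=> /INR_leq le; apply: Rmult_le_compat_r; [lra | nra]. Qed.

Lemma cone_angle_gt0 d : 0 < cone_angle d.
Proof.
have := Delta_ge3; have d0 := pos_INR d => D3; apply: Rmult_lt_0_compat; last lra.
by have -> : INR d + (INR Delta - INR d) * eps = (1 - eps) * INR d + INR Delta * eps;
  [ring | nra].
Qed.

Lemma cone_angle_last_lt : cone_angle (Delta - 1) < PI / 3.
Proof.
have D3 := Delta_ge3; rewrite /cone_angle INR_Delta_pred.
have [_] := theta_bounds; set r := 3 * _ => theta_lt; have r0 : 0 < r by rewrite /r; lra.
have := Rmult_lt_compat_r r _ _ r0 theta_lt.
by rewrite /Rdiv Rmult_assoc Rinv_l; rewrite /r; lra.
Qed.

Lemma cone_angle_le_PI3 d : (d < Delta)%N -> cone_angle d <= PI / 3.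
Proof.
move=> lt_d; apply: Rle_trans (Rlt_le _ _ cone_angle_last_lt).
by apply: cone_angle_le; rewrite subn1 -ltnS prednK // Delta_gt0.
Qed.

Lemma cone_angle_le_PI2 d : (d <= Delta)%N -> cone_angle d <= PI / 2.
Proof.
move=> /cone_angle_le le_d; apply: Rle_trans le_d _; have D3 := Delta_ge3.
by have := cone_angle_last_lt; rewrite /cone_angle INR_Delta_pred; nra.
Qed.

Lemma fdK_gt0 d : (d <= Delta)%N -> 0 < fdK d K (cone_angle d).
Proof.
move=> le_d; apply: Rlt_le_trans (fdK_sin_le d K _).
have := cone_angle_gt0 d; have := cone_angle_le_PI2 le_d; have := PI_RGT_0 => pi le lt.
by have := sin_gt_0 (cone_angle d / 2); lra.
Qed.

Lemma mul_K_le_cone_angle d : (d <= Delta)%N -> INR d * K <= cone_angle d.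
Proof.
move=> /INR_leq le_d; have d0 := pos_INR d; have := K_le_theta => K_le.
by apply: Rmult_le_compat; nra.
Qed.

Lemma denom_lastE : den (Delta - 1)
  = cos (cone_angle (Delta - 1) / 2) * (INR k - 1) - eps * (1 + K) ^ (Delta - 1).
Proof.
rewrite /denom -/(cone_angle (Delta - 1)).
have -> : INR Delta - INR (Delta - 1) = 1 by rewrite INR_Delta_pred; ring.
by ring.
Qed.

Lemma lt_last_Delta : (Delta - 1 < Delta)%N.
Proof. by rewrite subn1 prednK // Delta_gt0. Qed.

Lemma Delta_succ_le_k : INR Delta + 1 <= INR k.
Proof. by rewrite -S_INR; apply: INR_leq. Qed.

Lemma cos_half_last_gt : 43 / 50 < cos (cone_angle (Delta - 1) / 2).
Proof.
by apply: cos_gt_43_50; have := cone_angle_gt0 (Delta - 1); have := cone_angle_last_lt; lra.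
Qed.

Lemma denom_last_gt0 : 0 < den (Delta - 1).
Proof.
have q_lt : (1 + K) ^ (Delta - 1) < 43 / 50 * (INR (Delta - 1) + 1).
  apply: pow_1p_lt; [by rewrite leq_subRL // (leq_trans _ Delta3) | lra |].
  have := mul_K_le_cone_angle (ltnW lt_last_Delta).
  by have := cone_angle_last_lt; have := PI_lt_33_10; lra.
have q1 := pow_1p_ge1 (Delta - 1) (Rlt_le _ _ (proj1 K01)).
rewrite denom_lastE; rewrite INR_Delta_pred in q_lt.
by have := cos_half_last_gt; have := Delta_succ_le_k; have := Delta_ge3; nra.
Qed.

(* The first condition serves the vertices that already carry a pendant when another one is
   added, so that [d <= Delta - 2]; the second one serves the others. *)
Hypothesis fixed_condition : forall d, (d <= Delta - 2)%N ->
  (1 + eps) ^ 2 * (1 + K) ^ d / den d <= K.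
Hypothesis free_condition : forall d, (d <= Delta - 1)%N ->
  (1 + eps) * (1 + K) ^ d / den d <= K / fdK d K (cone_angle d).

(* A nonpositive denominator would make the conditions trivial, as [x / 0 = 0]. The denominator at
   [Delta - 1] is positive outright, and there the second condition bounds it from below by enough
   to make all the others positive. *)
Lemma denom_last_gt :
  INR (Delta - 1) * (1 + eps * (1 + K) ^ (Delta - 1)) < den (Delta - 1).
Proof.
have := Rdiv_le_div denom_last_gt0 (fdK_gt0 (ltnW lt_last_Delta)) (free_condition (leqnn _)).
have := fdK_sin_le (Delta - 1) K (cone_angle (Delta - 1)).
have := mul_K_le_cone_angle (ltnW lt_last_Delta); have := cone_angle_last_lt.
have pi33 := PI_lt_33_10; have D3 := Delta_ge3.
have : 1 + INR (Delta - 1) * K <= (1 + K) ^ (Delta - 1) by apply: poly; lra.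
rewrite INR_Delta_pred; set m := INR Delta - 1; set f := fdK _ _ _; set phi := cone_angle _.
set q := (1 + K) ^ _ => q_ge phi_lt mK_le f_ge cond.
have pi := PI_RGT_0; have mK0 : 0 < m * K by apply: Rmult_lt_0_compat; rewrite /m; lra.
have := two_sin_half_mul_ge (t := m * K) (ltac:(lra)) q_ge => chord_ge.
have sin_le : sin (m * K / 2) <= sin (phi / 2) by apply: sin_incr_1; lra.
have qf_ge : m * K * (q + 1) <= 2 * q * f.
  by apply: Rle_trans chord_ge _; apply: Rmult_le_compat_l; lra.
apply: (Rmult_lt_reg_l (2 * K)); first lra.
have : (1 + eps) * (m * K * (q + 1)) <= 2 * (K * den (Delta - 1)).
  by apply: Rle_trans (Rmult_le_compat_l _ _ _ _ qf_ge) _; lra.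
have : 0 < m * K * ((1 - eps) * (q - 1)) by apply: Rmult_lt_0_compat => //; nra.
by lra.
Qed.

Lemma denom_Delta_gt0 : 0 < den Delta.
Proof.
rewrite /denom -/(cone_angle Delta) Rminus_diag !Rmult_0_r Rmult_0_l !Rminus_0_r.
have angle_gt0 := cone_angle_gt0 Delta; have angle_le := cone_angle_le_PI2 (leqnn Delta).
have D3 := Delta_ge3; have kD := Delta_succ_le_k; have pi := PI_RGT_0.
by apply: Rmult_lt_0_compat; [apply: cos_gt_0; lra | lra].
Qed.

Lemma denom_gt0 d : (d <= Delta)%N -> 0 < den d.
Proof.
rewrite leq_eqVlt => /orP [/eqP -> | lt_d]; first exact: denom_Delta_gt0.
have le_d : (d <= Delta - 1)%N by rewrite subn1 -ltnS prednK // Delta_gt0.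
have := denom_last_gt; rewrite denom_lastE /denom -/(cone_angle d).
have := INR_leq le_d; rewrite INR_Delta_pred.
have cos_le : cos (cone_angle (Delta - 1) / 2) <= cos (cone_angle d / 2).
  have := cone_angle_gt0 d; have := cone_angle_le le_d; have := cone_angle_last_lt => lt le gt.
  by have pi := PI_RGT_0; apply: cos_decr_1; lra.
have q_le : (1 + K) ^ d <= (1 + K) ^ (Delta - 1) by apply: Rle_pow; [lra | apply/leP].
have [_ c1] := COS_bound (cone_angle (Delta - 1) / 2); have c0 := cos_half_last_gt.
move: cos_le q_le c0 c1.
set c := cos (cone_angle (Delta - 1) / 2); set c' := cos (cone_angle d / 2).
set q := (1 + K) ^ (Delta - 1); set q' := (1 + K) ^ d.
have b_bounds : 1 <= INR Delta - INR d <= INR Delta.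
  by have := pos_INR d; have := INR_leq lt_d; rewrite S_INR; lra.
move: b_bounds; set b := INR Delta - INR d => b_bounds cos_le q_le c0 c1 _ last_gt.
have kD := Delta_succ_le_k; have q'1 := pow_1p_ge1 d (Rlt_le _ _ (proj1 K01)).
have good_ge : c * (INR k - b) <= c' * (INR k - b) by apply: Rmult_le_compat_r; lra.
have bad_le : eps * b * q' <= eps * b * q by apply: Rmult_le_compat_l; nra.
have : (b - 1) * (c + eps * q) <= (INR Delta - 1) * (1 + eps * q).
  by apply: Rmult_le_compat; rewrite -/q' in q'1; nra.
by lra.
Qed.

Lemma fixed_condition_mul d : (d <= Delta - 2)%N ->
  (1 + eps) ^ 2 * (1 + K) ^ d <= K * den d.
Proof.
move=> le_d; apply/Rdiv_le_iff; last exact: fixed_condition.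
by apply: denom_gt0; apply: leq_trans le_d (leq_subr _ _).
Qed.

Lemma free_condition_mul d : (d <= Delta - 1)%N ->
  (1 + eps) * (1 + K) ^ d * fdK d K (cone_angle d) <= K * den d.
Proof.
move=> le_d; have le_Delta := leq_trans le_d (leq_subr _ _).
by apply: Rdiv_le_div; [exact: denom_gt0 | exact: fdK_gt0 | exact: free_condition].
Qed.

(** * Stability under recolouring a pendant *)

Definition admissible (a : cplx) : Prop :=
  Cnorm a <= eps \/ (Cabs_arg a <= eps * theta /\ eps < Cnorm a <= 1).
Definition bad_pend l q : bool := Rle_dec (Cnorm q.1) eps && (q.2 == l).
Definition bad_colour s l : bool := has (bad_pend l) s.
Definition admissible_pends s : Prop := List.Forall (fun q => admissible q.1) s.

Lemma theta_gt0 : 0 < theta.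
Proof. by case: theta_bounds. Qed.

Lemma admissible_le1 a : admissible a -> Cnorm a <= 1.
Proof. by case=> [|[]]; lra. Qed.

Lemma admissible_sub1 a : admissible a -> Cnorm (Csub a C1) <= 1 + eps.
Proof.
case=> [a_le | [arg_le a_bounds]].
  by have := Cnorm_sub_le a C1; rewrite Cnorm1; lra.
apply: Rle_trans (_ : 1 <= _); last lra.
apply: chord_le_max; rewrite ?Cnorm1; try lra; apply: Rle_trans arg_le _.
have := cone_angle_le_PI3 Delta_gt0; rewrite /cone_angle /=.
have D3 := Delta_ge3; have th0 := theta_gt0.
have et0 : 0 <= eps * theta by nra.
by have := Rmult_le_compat_r _ 1 _ et0 (ltac:(lra) : 1 <= INR Delta); lra.
Qed.

Lemma Cnorm_pend_weight_le s l : admissible_pends s ->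
  Cnorm (pend_weight s l) <= eps ^ count (bad_pend l) s.
Proof.
rewrite /pend_weight; elim=> [|q {}s q_ok _ IH]; first by rewrite big_nil Cnorm1 /=; lra.
rewrite big_cons CnormM /= pow_add; apply: Rmult_le_compat => //; try exact: Cnorm_ge0.
rewrite /pend_factor /bad_pend; case: (q.2 == l); last by rewrite Cnorm1 andbF /=; lra.
by rewrite andbT; case: Rle_dec => q_le /=; [lra | exact: admissible_le1].
Qed.

Lemma pend_factor_neq0 q l : ~~ bad_pend l q -> pend_factor q l <> C0.
Proof.
rewrite /bad_pend /pend_factor Cnorm_gt0; case: (q.2 == l); last by rewrite Cnorm1; lra.
by rewrite andbT; case: Rle_dec => //=; lra.
Qed.

Lemma pend_weight_neq0 s l : ~~ bad_colour s l -> pend_weight s l <> C0.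
Proof.
rewrite /bad_colour /pend_weight; elim: s => [|q s IH].
  by rewrite big_nil Cnorm_gt0 Cnorm1; lra.
rewrite /= negb_or big_cons => /andP [q_ok s_ok].
by apply: Cmul_neq0; [exact: pend_factor_neq0 | exact: IH].
Qed.

Lemma Cangle_pend_factor_le q l l' : admissible q.1 -> ~~ bad_pend l q -> ~~ bad_pend l' q ->
  Cangle (pend_factor q l) (pend_factor q l') <= eps * theta.
Proof.
have et : 0 <= eps * theta by have := theta_gt0; nra.
have n1 : C1 <> C0 by rewrite Cnorm_gt0 Cnorm1; lra.
have arg_le : admissible q.1 -> ~~ Rle_dec (Cnorm q.1) eps -> Cangle q.1 C1 <= eps * theta.
  by case=> [|[]//]; case: Rle_dec.
move=> q_ok; rewrite /bad_pend /pend_factor.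
case: (q.2 == l); case: (q.2 == l'); rewrite ?andbT ?andbF => h h'.
- rewrite Cangle_refl //; apply/Cnorm_gt0.
  by move: h; case: Rle_dec => //=; lra.
- exact: arg_le.
- by rewrite CangleC; exact: arg_le.
by rewrite Cangle_refl.
Qed.

Lemma Cangle_pend_weight_le s l l' : admissible_pends s ->
  ~~ bad_colour s l -> ~~ bad_colour s l' ->
  Cangle (pend_weight s l) (pend_weight s l') <= INR (size s) * (eps * theta).
Proof.
elim=> [_ _|q {}s q_ok _ IH].
  rewrite /pend_weight !big_nil Cangle_refl /=; first lra.
  by rewrite Cnorm_gt0 Cnorm1; lra.
move=> /norP [q_l s_l] /norP [q_l' s_l'].
rewrite -[size (q :: s)]/((size s).+1) S_INR /pend_weight !big_cons.
have := CangleM_le (pend_factor_neq0 q_l) (pend_factor_neq0 q_l')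
  (pend_weight_neq0 s_l) (pend_weight_neq0 s_l').
by have := Cangle_pend_factor_le q_ok q_l q_l'; have := IH s_l s_l'; rewrite /pend_weight /=; lra.
Qed.

Lemma bad_colour_mem s l : bad_colour s l -> l \in map snd s.
Proof.
elim: s => //= q s IH /orP [/andP [_ /eqP <-]|/IH]; first exact: mem_head.
by rewrite inE => ->; rewrite orbT.
Qed.

Lemma good_colour_not_bad s l : good_colour s l -> ~~ bad_colour s l.
Proof. by apply: contra => /bad_colour_mem. Qed.

Lemma card_bad_colour_le s : (#|bad_colour s| <= size s)%N.
Proof.
rewrite -(size_map snd); apply: leq_trans (card_size _).
by apply/subset_leq_card/subsetP => l; rewrite unfold_in => /bad_colour_mem.
Qed.

Definition admissible_boundary S c : Prop := forall v, v \in S ->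
  (#|nbrs S v| + size (c v) <= Delta)%N /\ admissible_pends (c v).

Definition recolour_stable S : Prop := forall psi c, admissible_boundary S c ->
  Zpend S psi c <> C0 /\
  forall v a l l', v \in S -> admissible a -> (#|nbrs S v| + size (c v) < Delta)%N ->
    ratio_within theta (1 + K)
      (Zpend S psi (add_pend c v (a, l))) (Zpend S psi (add_pend c v (a, l'))).

Hypothesis weights : forall u v, (u < v)%N -> adj u v -> admissible (w u v).

Lemma admissible_wt u v : adj u v -> admissible (wt w u v).
Proof.
rewrite /wt; case: ltngtP => [uv|vu|/val_inj ->]; last by rewrite adj_irr.
  exact: weights.
by rewrite adj_sym; exact: weights.
Qed.

Lemma admissible_boundary_add_leaves S u A c col :
  u \in S -> A \subset nbrs S u -> admissible_boundary S c ->
  admissible_boundary (S :\ u) (add_leaves u A c col).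
Proof.
move=> uS /subsetP sub adm_c v; rewrite in_setD1 => /andP [_ vS].
have [] := adm_c v vS; rewrite (card_nbrsD1 _ uS) /add_leaves => size_le c_ok.
case: ifP => [/sub|_]; last by split=> //; apply: leq_trans size_le; rewrite addnAC leq_addr.
rewrite inE => /andP [_ uv]; rewrite uv addn1 addSnnS in size_le.
by split=> //; constructor=> //; apply: admissible_wt.
Qed.

Lemma admissible_boundary_add_pend S c v a l : admissible_boundary S c -> admissible a ->
  (#|nbrs S v| + size (c v) < Delta)%N -> admissible_boundary S (add_pend c v (a, l)).
Proof.
move=> adm_c a_ok size_lt y yS; have [size_le c_ok] := adm_c y yS; rewrite /add_pend.
case: eqP size_le c_ok => [->|//] _ c_ok.
by split; [rewrite /= addnS | constructor].
Qed.

Section RemovedVertex.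

Variables (S : {set 'I_n}) (psi : {ffun 'I_n -> 'I_k}) (c : 'I_n -> seq pendant) (u : 'I_n).
Hypotheses (uS : u \in S) (adm_c : admissible_boundary S c) (stableD1 : recolour_stable (S :\ u)).

Local Notation Zleaves col := (Zpend (S :\ u) psi (add_leaves u (nbrs S u) c col)).

Lemma Zpend_leaves_neq0 col : Zleaves col <> C0.
Proof. by have [] := stableD1 psi (admissible_boundary_add_leaves col uS (subxx _) adm_c). Qed.

Lemma recolour_leaf_ratio v col l : v \in nbrs S u ->
  ratio_within theta (1 + K) (Zleaves col) (Zleaves (fun y => if y == v then l else col y)).
Proof.
move=> v_nbr; have := v_nbr; rewrite inE => /andP [vS uv].
have vu : v != u by apply/eqP => vu; rewrite vu adj_irr in uv.
pose c' := add_leaves u (nbrs S u :\ v) c col.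
have leaf col' : {in nbrs S u :\ v, col' =1 col} ->
    Zleaves col' = Zpend (S :\ u) psi (add_pend c' v (wt w u v, col' v)).
  move=> e_col; apply: eq_Zpend => y _; rewrite /add_pend /c' /add_leaves.
  case: eqP => [->|/eqP yv]; first by rewrite v_nbr in_setD1 eqxx.
  by rewrite in_setD1 yv /=; case: ifP => // y_nbr; rewrite e_col // in_setD1 yv.
rewrite (leaf col) // leaf => [|y]; last by rewrite in_setD1 => /andP [/negbTE ->].
have c'_ok : admissible_boundary (S :\ u) c'.
  by apply: admissible_boundary_add_leaves => //; apply: subsetDl.
have [_ leaf_ratio] := stableD1 psi c'_ok.
apply: leaf_ratio; rewrite ?in_setD1 ?vu //; first exact: admissible_wt.
have [size_le _] := adm_c vS; rewrite (card_nbrsD1 _ uS) uv addn1 addSn in size_le.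
by rewrite /c' /add_leaves in_setD1 eqxx.
Qed.

Lemma recolour_leaves_ratio l l' :
  ratio_within (INR #|nbrs S u| * theta) ((1 + K) ^ #|nbrs S u|)
    (Zleaves (fun=> l)) (Zleaves (fun=> l')).
Proof.
suff prefix_ratio (vs : seq 'I_n) : {subset vs <= nbrs S u} ->
    ratio_within (INR (size vs) * theta) ((1 + K) ^ size vs)
      (Zleaves (fun=> l)) (Zleaves (fun y => if y \in vs then l' else l)).
  have := prefix_ratio (enum (nbrs S u)) (fun v => _); rewrite -cardE.
  have -> : Zleaves (fun y => if y \in enum (nbrs S u) then l' else l) = Zleaves (fun=> l').
    by apply: eq_Zpend => y _; rewrite /add_leaves mem_enum; case: (y \in _).
  by apply=> v; rewrite mem_enum.
elim: vs => [_|v vs IH sub].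
  by rewrite /= Rmult_0_l; apply/ratio_within_refl/Zpend_leaves_neq0.
have {}IH := IH (fun y y_vs => sub y (mem_behead (s := v :: vs) y_vs)).
have step := recolour_leaf_ratio (fun y => if y \in vs then l' else l) l' (sub v (mem_head v vs)).
rewrite -[size (v :: vs)]/((size vs).+1) S_INR -tech_pow_Rmult Rmult_plus_distr_r Rmult_1_l.
have -> : Zleaves (fun y => if y \in v :: vs then l' else l)
    = Zleaves (fun y => if y == v then l' else if y \in vs then l' else l).
  by apply: eq_Zpend => y _; rewrite /add_leaves in_cons; case: (y == v).
by apply: ratio_within_trans IH step; lra.
Qed.

Lemma Zpend_at_neq0 l : ~~ bad_colour (c u) l -> Zpend_at S psi c u l <> C0.
Proof.
move=> not_bad; rewrite Zpend_atE //.
by apply: Cmul_neq0; [exact: pend_weight_neq0 | exact: Zpend_leaves_neq0].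
Qed.

Lemma Cangle_Zpend_at_le l l' : ~~ bad_colour (c u) l -> ~~ bad_colour (c u) l' ->
  Cangle (Zpend_at S psi c u l) (Zpend_at S psi c u l')
  <= (INR #|nbrs S u| + INR (size (c u)) * eps) * theta.
Proof.
move=> l_ok l'_ok; rewrite !Zpend_atE //.
have [z0 z'0 angle_le _] := recolour_leaves_ratio l l'.
have := CangleM_le (pend_weight_neq0 l_ok) (pend_weight_neq0 l'_ok) z0 z'0.
by have [_ c_ok] := adm_c uS; have := Cangle_pend_weight_le c_ok l_ok l'_ok; lra.
Qed.

Lemma Cnorm_Zpend_at_le l j : good_colour (c u) j ->
  Cnorm (Zpend_at S psi c u l)
  <= eps ^ count (bad_pend l) (c u) * (1 + K) ^ #|nbrs S u| * Cnorm (Zpend_at S psi c u j).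
Proof.
move=> good_j; rewrite !Zpend_atE // (pend_weight_good_colour good_j) Cmul1 CnormM Rmult_assoc.
have [_ _ _ norm_le] := recolour_leaves_ratio j l.
apply: Rmult_le_compat norm_le; try exact: Cnorm_ge0.
by apply: Cnorm_pend_weight_le; have [] := adm_c uS.
Qed.

Lemma Cnorm_Zpend_at_le_pow l j : good_colour (c u) j ->
  Cnorm (Zpend_at S psi c u l) <= (1 + K) ^ #|nbrs S u| * Cnorm (Zpend_at S psi c u j).
Proof.
move=> good_j; apply: Rle_trans (Cnorm_Zpend_at_le l good_j) _.
apply: Rmult_le_compat_r; first exact: Cnorm_ge0.
have := pow_1p_ge1 #|nbrs S u| (ltac:(lra) : 0 <= K).
by have := pow_le_one (count (bad_pend l) (c u)) (ltac:(lra) : 0 <= eps <= 1); nra.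
Qed.

Lemma Cnorm_Zpend_at_le_bad_colour l j : bad_colour (c u) l -> good_colour (c u) j ->
  Cnorm (Zpend_at S psi c u l)
  <= eps * (1 + K) ^ #|nbrs S u| * Cnorm (Zpend_at S psi c u j).
Proof.
rewrite /bad_colour has_count => bad_l good_j; apply: Rle_trans (Cnorm_Zpend_at_le l good_j) _.
apply: Rmult_le_compat_r; first exact: Cnorm_ge0.
apply: Rmult_le_compat_r; first by have := pow_1p_ge1 #|nbrs S u| (ltac:(lra) : 0 <= K); lra.
by apply: pow_le_base => //; lra.
Qed.

Lemma pend_angle_le_cone_angle :
  (INR #|nbrs S u| + INR (size (c u)) * eps) * theta <= cone_angle #|nbrs S u|.
Proof.
have [/INR_leq] := adm_c uS; rewrite -plusE plus_INR => size_le _.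
by apply: Rmult_le_compat_r; [exact/Rlt_le/theta_gt0 | nra].
Qed.

Lemma INR_card_good_colour_ge :
  INR k - (INR Delta - INR #|nbrs S u|) <= INR #|good_colour (c u)|.
Proof.
have [size_le _] := adm_c uS; have := INR_leq (card_good_colour_ge (c u)).
rewrite minus_INR; last first.
  by apply/leP/(leq_trans (leq_trans (leq_addl _ _) size_le)); exact: ltnW.
by have := INR_leq size_le; rewrite -plusE plus_INR; lra.
Qed.

Lemma INR_card_bad_colour_le : INR #|bad_colour (c u)| <= INR Delta - INR #|nbrs S u|.
Proof.
have [/INR_leq size_le _] := adm_c uS; rewrite -plusE plus_INR in size_le.
by have := INR_leq (card_bad_colour_le (c u)); lra.
Qed.

Lemma Cnorm_Zpend_ge : exists2 j, good_colour (c u) j &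
  den #|nbrs S u| * Cnorm (Zpend_at S psi c u j) <= Cnorm (Zpend S psi c).
Proof.
have [size_le _] := adm_c uS; have d_le := leq_trans (leq_addr _ _) size_le.
have /card_gt0P [j0 good_j0] : (0 < #|good_colour (c u)|)%N.
  apply: leq_trans (card_good_colour_ge _); rewrite subn_gt0; apply: leq_ltn_trans lt_Delta_k.
  exact: leq_trans (leq_addl _ _) size_le.
set a := Zpend_at S psi c u; set d := #|nbrs S u| in d_le *.
have [j good_j j_min] := exists_argmin (fun l => Cnorm (a l)) good_j0.
exists j => //; rewrite (Zpend_sum S psi c u) -/a.
have angle_gt0 := cone_angle_gt0 d; have angle_le := cone_angle_le_PI2 d_le.
have pi := PI_RGT_0; have angle_bounds : 0 <= cone_angle d < 2 * PI / 3 by lra.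
have pairwise i i' : ~~ bad_colour (c u) i -> ~~ bad_colour (c u) i' ->
    Cangle (a i) (a i') <= cone_angle d.
  move=> i_ok i'_ok; apply: Rle_trans pend_angle_le_cone_angle; exact: Cangle_Zpend_at_le.
have sum_ge : cos (cone_angle d / 2) * (INR #|good_colour (c u)| * Cnorm (a j))
    - INR #|bad_colour (c u)| * (eps * (1 + K) ^ d * Cnorm (a j)) <= Cnorm (\big[Cadd/C0]_l a l).
  exact: Cnorm_sum_ge_cone_defect angle_bounds (@good_colour_not_bad (c u)) Zpend_at_neq0 pairwise
    j_min (fun i bad_i => Cnorm_Zpend_at_le_bad_colour bad_i good_j).
have cos0 : 0 <= cos (cone_angle d / 2) by apply: cos_ge_0; lra.
have m0 := Cnorm_ge0 (a j); have q1 := pow_1p_ge1 d (ltac:(lra) : 0 <= K).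
have y0 : 0 <= eps * (1 + K) ^ d * Cnorm (a j) by apply: Rmult_le_pos => //; nra.
rewrite /denom -/(cone_angle d) -/(a j).
have := Rmult_le_compat_l _ _ _ cos0 (Rmult_le_compat_r _ _ _ m0 INR_card_good_colour_ge).
by have := Rmult_le_compat_r _ _ _ y0 INR_card_bad_colour_le; rewrite -/d; lra.
Qed.

Lemma Cnorm_sub_Zpend_at_le_no_pend l l' j : (#|nbrs S u| < Delta)%N -> c u = [::] ->
  (1 + eps) * Cnorm (Csub (Zpend_at S psi c u l') (Zpend_at S psi c u l))
  <= K * den #|nbrs S u| * Cnorm (Zpend_at S psi c u j).
Proof.
move=> d_lt cu0; have good i : good_colour (c u) i by rewrite cu0.
have not_bad i : ~~ bad_colour (c u) i by exact: good_colour_not_bad.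
set d := #|nbrs S u| in d_lt *; set a := Zpend_at S psi c u.
have ratio i i' : Cnorm (a i) <= (1 + K) ^ d * Cnorm (a i') by exact: Cnorm_Zpend_at_le_pow.
have angle_le := Rle_trans _ _ _ (Cangle_Zpend_at_le (not_bad l') (not_bad l))
  pend_angle_le_cone_angle.
have cone_le := cone_angle_le_PI3 d_lt; have pi := PI_RGT_0.
have chord_le : Cnorm (Csub (a l') (a l))
    <= fdK d K (cone_angle d) * ((1 + K) ^ d * Cnorm (a j)).
  by apply: chord_le_fdK => //; [lra | split=> //; lra].
have d_le : (d <= Delta - 1)%N by rewrite subn1 -ltnS prednK // Delta_gt0.
have := Rmult_le_compat_r _ _ _ (Cnorm_ge0 (a j)) (free_condition_mul d_le).
by have := Rmult_le_compat_l (1 + eps) _ _ (ltac:(lra)) chord_le; lra.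
Qed.

Lemma Cnorm_sub_Zpend_at_le_pend l l' j :
  (#|nbrs S u| + size (c u) < Delta)%N -> (0 < size (c u))%N -> good_colour (c u) j ->
  (1 + eps) * Cnorm (Csub (Zpend_at S psi c u l') (Zpend_at S psi c u l))
  <= K * den #|nbrs S u| * Cnorm (Zpend_at S psi c u j).
Proof.
move=> size_lt size_gt0 good_j; set d := #|nbrs S u| in size_lt *; set a := Zpend_at S psi c u.
have norm_le i : Cnorm (a i) <= (1 + K) ^ d * Cnorm (a j) by exact: Cnorm_Zpend_at_le_pow.
have bad_le i : bad_colour (c u) i -> Cnorm (a i) <= eps * ((1 + K) ^ d * Cnorm (a j)).
  by move=> bad_i; rewrite -Rmult_assoc; exact: Cnorm_Zpend_at_le_bad_colour.
have d_lt : (d < Delta)%N by apply: leq_ltn_trans size_lt; apply: leq_addr.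
have m0 : 0 <= (1 + K) ^ d * Cnorm (a j).
  by apply: Rle_trans (norm_le j); exact: Cnorm_ge0.
have sub_le : Cnorm (Csub (a l') (a l)) <= (1 + eps) * ((1 + K) ^ d * Cnorm (a j)).
  have := Cnorm_sub_le (a l') (a l); have := norm_le l; have := norm_le l'.
  case: (boolP (bad_colour (c u) l')) => [/bad_le|l'_ok]; first lra.
  case: (boolP (bad_colour (c u) l)) => [/bad_le|l_ok]; first lra.
  move=> le' le _; apply: (Rle_trans _ ((1 + K) ^ d * Cnorm (a j))); last nra.
  apply: chord_le_max => //; apply: Rle_trans (Cangle_Zpend_at_le l'_ok l_ok) _.
  exact: Rle_trans pend_angle_le_cone_angle (cone_angle_le_PI3 d_lt).
have d_le : (d <= Delta - 2)%N.
  rewrite leq_subRL ?(ltnW Delta3) // add2n; apply: leq_trans size_lt.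
  by rewrite ltnS -addn1 leq_add2l.
have := Rmult_le_compat_r _ _ _ (Cnorm_ge0 (a j)) (fixed_condition_mul d_le).
by have := Rmult_le_compat_l (1 + eps) _ _ (ltac:(lra)) sub_le; rewrite /=; lra.
Qed.

End RemovedVertex.

Lemma recolour_pend_ratio S psi c v a l l' : v \in S -> admissible_boundary S c -> admissible a ->
  (#|nbrs S v| + size (c v) < Delta)%N -> recolour_stable (S :\ v) ->
  ratio_within theta (1 + K)
    (Zpend S psi (add_pend c v (a, l))) (Zpend S psi (add_pend c v (a, l'))).
Proof.
move=> vS adm_c a_ok size_lt stableD1.
have add_ok := admissible_boundary_add_pend l adm_c a_ok size_lt.
have d_lt : (#|nbrs S v| < Delta)%N by apply: leq_ltn_trans size_lt; apply: leq_addr.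
have [j] := Cnorm_Zpend_ge psi vS add_ok stableD1.
rewrite {1}/add_pend eqxx Zpend_at_add_pend // {1}/good_colour /= inE negb_or => /andP [jl good_j].
rewrite /pend_factor eq_sym (negbTE jl) Cmul1 => Z_ge.
have a_gt0 : 0 < Cnorm (Zpend_at S psi c v j).
  by apply/Cnorm_gt0/Zpend_at_neq0 => //; exact: good_colour_not_bad.
have sub_le : (1 + eps) * Cnorm (Csub (Zpend_at S psi c v l') (Zpend_at S psi c v l))
    <= K * den #|nbrs S v| * Cnorm (Zpend_at S psi c v j).
  have [/size0nil cv0|size_gt0] := posnP (size (c v)).
    exact: Cnorm_sub_Zpend_at_le_no_pend.
  exact: Cnorm_sub_Zpend_at_le_pend.
apply: ratio_within_of_sub; first lra.
  apply/Cnorm_gt0; apply: Rlt_le_trans Z_ge; apply: Rmult_lt_0_compat => //.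
  exact/denom_gt0/ltnW.
rewrite Zpend_sub_add_pend // CnormM.
apply: Rle_trans (Rmult_le_compat_r _ _ _ (Cnorm_ge0 _) (admissible_sub1 a_ok)) _.
by apply: Rle_trans sub_le _; rewrite Rmult_assoc; apply: Rmult_le_compat_l Z_ge; lra.
Qed.

Lemma all_recolour_stable S : recolour_stable S.
Proof.
have [m] := ubnP #|S|; elim: m S => // m IH S S_le psi c adm_c.
have stableD1 u : u \in S -> recolour_stable (S :\ u).
  by move=> uS; apply: IH; move: S_le; rewrite (cardsD1 u) uS.
split; last by move=> v a l l' vS a_ok size_lt; apply: recolour_pend_ratio => //; exact: stableD1.
have [->|[u uS]] := set_0Vmem S; first by rewrite Zpend_set0 Cnorm_gt0 Cnorm1; lra.
have [j good_j Z_ge] := Cnorm_Zpend_ge psi uS adm_c (stableD1 u uS).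
apply/Cnorm_gt0; apply: Rlt_le_trans Z_ge; apply: Rmult_lt_0_compat.
  by apply: denom_gt0; have [+ _] := adm_c u uS; apply: leq_trans; exact: leq_addr.
exact/Cnorm_gt0/Zpend_at_neq0/good_colour_not_bad/good_j/stableD1.
Qed.

(** * Restricted partition functions *)

Hypothesis max_deg : max_deg_le adj Delta.

Lemma admissible_boundary_fixed_pend W L :
  uniq W -> admissible_boundary (free_set W) (fixed_pend W L).
Proof.
move=> uW v _; split; first by rewrite size_fixed_pend.
rewrite /fixed_pend; move: (fixed_col W L col0) => col {uW}.
elim: W => [|x W IH] /=; first by constructor.
by case: (boolP (adj v x)) => vx //=; constructor=> //; exact: admissible_wt.
Qed.

Lemma count_bad_pend_fixed_pend W L u l : uniq W -> size L = size W ->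
  count (bad_pend l) (fixed_pend W L u) = m_bad adj w eps W L u l.
Proof.
move=> uW sL; rewrite count_map count_filter -size_filter /m_bad.
rewrite -(card_uniqP (filter_uniq _ uW)); apply: eq_card => x.
rewrite !inE mem_filter /fixed_nb /= /bad_pend /=.
case: (boolP (x \in W)) => xW; last by rewrite !andbF.
by rewrite (fixed_colE l col0 sL xW) !andbT andbC.
Qed.

Lemma not_bad_colour_fixed_pend W L u l : uniq W -> size L = size W ->
  ~ bad_col adj w eps W L u l -> ~~ bad_colour (fixed_pend W L u) l.
Proof.
move=> uW sL not_bad; rewrite /bad_colour has_count count_bad_pend_fixed_pend //.
apply/negP => /card_gt0P [x]; rewrite inE => /and3P [nb_x x_le /eqP col_x].
by apply: not_bad; exists x; split=> //; split=> //; move: x_le; case: Rle_dec.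
Qed.

Lemma good_col_not_bad W L u l : good_col adj W L u l -> ~ bad_col adj w eps W L u l.
Proof. by move=> good_l [v [nb_v [_ col_v]]]; apply: (good_l v). Qed.

Lemma Zr_neq0 W L : uniq W -> independent W -> size L = size W -> Zr adj w W L <> C0.
Proof.
move=> uW indep sL; rewrite Zr_Zpend //.
by have [] := all_recolour_stable (fixed_colouring W L) (admissible_boundary_fixed_pend L uW).
Qed.

Section LastVertex.

Variables (W : seq 'I_n) (L : seq 'I_k) (u : 'I_n).
Hypotheses (uWu : uniq (rcons W u)) (indep : independent W) (sL : size L = size W).

Local Notation Z l := (Zr adj w (rcons W u) (rcons L l)).

Lemma uniq_init : uniq W.
Proof. by move: uWu; rewrite rcons_uniq => /andP []. Qed.

Lemma last_free : u \in free_set W.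
Proof. by move: uWu; rewrite rcons_uniq inE => /andP []. Qed.

Lemma Zr_rcons_neq0 l : ~ bad_col adj w eps W L u l -> Z l <> C0.
Proof.
move=> not_bad; rewrite Zr_rcons //.
apply: Zpend_at_neq0; [exact: last_free | exact/admissible_boundary_fixed_pend/uniq_init | |].
  exact: all_recolour_stable.
exact: not_bad_colour_fixed_pend uniq_init sL not_bad.
Qed.

Lemma Cangle_Zr_rcons_le l l' :
  ~ bad_col adj w eps W L u l -> ~ bad_col adj w eps W L u l' ->
  Cangle (Z l) (Z l')
  <= (INR (n_free_nb adj W u) + (INR (deg adj u) - INR (n_free_nb adj W u)) * eps) * theta.
Proof.
move=> not_bad not_bad'; rewrite !Zr_rcons //.
have := Cangle_Zpend_at_le (fixed_colouring W L) last_free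
  (admissible_boundary_fixed_pend L uniq_init) (@all_recolour_stable _)
  (not_bad_colour_fixed_pend uniq_init sL not_bad)
  (not_bad_colour_fixed_pend uniq_init sL not_bad').
rewrite -(size_fixed_pend L u uniq_init) -plusE plus_INR card_nbrs_free_set.
by rewrite Rplus_minus_l.
Qed.

Lemma Cnorm_Zr_rcons_ratio_le l j : good_col adj W L u j ->
  Cnorm (Z l) / Cnorm (Z j)
  <= eps ^ m_bad adj w eps W L u l * (1 + K) ^ n_free_nb adj W u.
Proof.
move=> good_j; apply/Rdiv_le_iff.
  exact/Cnorm_gt0/Zr_rcons_neq0/good_col_not_bad.
rewrite !Zr_rcons //.
have := Cnorm_Zpend_at_le (fixed_colouring W L) last_free
  (admissible_boundary_fixed_pend L uniq_init) (@all_recolour_stable _) l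
  (good_colour_fixed_pend sL good_j).
by rewrite count_bad_pend_fixed_pend ?uniq_init // card_nbrs_free_set.
Qed.

Lemma Cangle_Zr_rcons_le_cone_angle l l' :
  ~ bad_col adj w eps W L u l -> ~ bad_col adj w eps W L u l' ->
  Cangle (Z l) (Z l') <= cone_angle (n_free_nb adj W u).
Proof.
move=> not_bad not_bad'; apply: Rle_trans (Cangle_Zr_rcons_le not_bad not_bad') _.
have deg_le := INR_leq (max_deg u).
by apply: Rmult_le_compat_r; [exact/Rlt_le/theta_gt0 | nra].
Qed.

Hypothesis leaf : leaf_independent adj (rcons W u).

Lemma leaf_no_fixed_nb v : fixed_nb adj W u v = false.
Proof.
apply/negP => /andP [uv vW]; have [indep' _] := leaf.
by rewrite indep' // mem_rcons ?mem_head // inE vW orbT in uv.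
Qed.

Lemma leaf_good_col l : good_col adj W L u l.
Proof. by move=> v; rewrite leaf_no_fixed_nb. Qed.

Lemma leaf_m_bad l : m_bad adj w eps W L u l = 0%N.
Proof. by apply: eq_card0 => v; rewrite inE leaf_no_fixed_nb. Qed.

Lemma leaf_deg : deg adj u = 1%N.
Proof. by have [_ ->] := leaf; rewrite ?mem_rcons ?mem_head. Qed.

Lemma leaf_n_free_nb : n_free_nb adj W u = 1%N.
Proof.
rewrite -leaf_deg; apply: eq_card => v; have := leaf_no_fixed_nb v.
by rewrite !inE /fixed_nb; case: (adj u v) => //= ->.
Qed.

Lemma Cangle_Zr_leaf_le l l' : Cangle (Z l) (Z l') <= theta.
Proof.
have not_bad i := good_col_not_bad (@leaf_good_col i).
have := Cangle_Zr_rcons_le (not_bad l) (not_bad l').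
by rewrite leaf_deg leaf_n_free_nb /=; lra.
Qed.

Lemma Cnorm_Zr_leaf_ratio_le l l' : Cnorm (Z l) / Cnorm (Z l') <= 1 + K.
Proof.
have := Cnorm_Zr_rcons_ratio_le l (@leaf_good_col l').
by rewrite leaf_m_bad leaf_n_free_nb /=; lra.
Qed.

End LastVertex.

End ZeroFreeness.

End PartitionFunction.

Theorem theorem5p1 (Delta k : nat) (eps K : R) :
  (3 <= Delta)%N -> (Delta < k)%N ->
  (0 < eps < 1) -> (0 < K < 1) ->
  let theta := asin K in
  (0 < theta < PI / (3 * (INR Delta - 1 + eps))) ->
  (forall d : nat, (d <= Delta - 2)%N ->
     ((1 + eps) ^ 2 * (1 + K) ^ d / denom Delta d k eps K theta <= K)) ->
  (forall d : nat, (d <= Delta - 1)%N ->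
     ((1 + eps) * (1 + K) ^ d / denom Delta d k eps K theta
        <= K / fdK d K ((INR d + (INR Delta - INR d) * eps) * theta))) ->
  forall (n : nat) (adj : rel 'I_n) (w : 'I_n -> 'I_n -> cplx),
  simple_graph adj -> max_deg_le adj Delta ->
  (forall u v : 'I_n, (u < v)%N -> adj u v ->
     (Cnorm (w u v) <= eps) \/
     ((Cabs_arg (w u v) <= eps * theta) /\ (eps < Cnorm (w u v) <= 1))) ->
  (* (A') *)
  (forall (W : seq 'I_n) (L : seq 'I_k),
     uniq W -> leaf_independent adj W -> size L = size W ->
     Zr adj w W L <> C0) /\
  (* (B') *)
  (forall (W' : seq 'I_n) (u : 'I_n) (L' : seq 'I_k) (l l' : 'I_k),
     uniq (rcons W' u) -> leaf_independent adj (rcons W' u) ->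
     size L' = size W' ->
     (Cangle (Zr adj w (rcons W' u) (rcons L' l))
             (Zr adj w (rcons W' u) (rcons L' l')) <= theta) /\
     (Cnorm (Zr adj w (rcons W' u) (rcons L' l))
        / Cnorm (Zr adj w (rcons W' u) (rcons L' l')) <= 1 + K)) /\
  (* (cplx') *)
  (forall (W' : seq 'I_n) (u : 'I_n) (L' : seq 'I_k),
     uniq (rcons W' u) -> leaf_independent adj W' -> size L' = size W' ->
     let d := n_free_nb adj W' u in
     let GN := fun l => good_col adj W' L' u l \/ neutral_col adj w eps W' L' u l in
     (forall l, GN l -> Zr adj w (rcons W' u) (rcons L' l) <> C0) /\
     (forall l l', GN l -> GN l' ->
        (Cangle (Zr adj w (rcons W' u) (rcons L' l))
                (Zr adj w (rcons W' u) (rcons L' l'))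
           <= (INR d + (INR Delta - INR d) * eps) * theta)) /\
     (forall l j, good_col adj W' L' u j ->
        (Cnorm (Zr adj w (rcons W' u) (rcons L' l))
           / Cnorm (Zr adj w (rcons W' u) (rcons L' j))
           <= eps ^ (m_bad adj w eps W' L' u l) * (1 + K) ^ d))).
Proof.
move=> Delta3 lt_Delta_k eps01 K01 theta theta_bounds fixed_condition free_condition.
move=> n adj w adj_simple max_deg weights.
pose col0 : 'I_k := Ordinal (leq_ltn_trans (leq0n Delta) lt_Delta_k).
split; last split.
- move=> W L uW [indep _] sL.
  exact: (Zr_neq0 adj_simple col0 Delta3 lt_Delta_k eps01 K01 theta_bounds).
- move=> W u L l l' uWu leaf sL; have indep := independent_rcons (proj1 leaf); split.
    exact: (Cangle_Zr_leaf_le adj_simple col0 Delta3 lt_Delta_k eps01 K01 theta_bounds).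
  exact: (Cnorm_Zr_leaf_ratio_le adj_simple col0 Delta3 lt_Delta_k eps01 K01 theta_bounds).
move=> W u L uWu [indep _] sL d GN.
have not_bad l : GN l -> ~ bad_col adj w eps W L u l.
  by case=> [/good_col_not_bad | []].
split; last split.
- move=> l /not_bad.
  exact: (Zr_rcons_neq0 adj_simple col0 Delta3 lt_Delta_k eps01 K01 theta_bounds).
- move=> l l' /not_bad l_ok /not_bad.
  exact: (Cangle_Zr_rcons_le_cone_angle adj_simple col0 Delta3 lt_Delta_k eps01 K01 theta_bounds).
move=> l j.
exact: (Cnorm_Zr_rcons_ratio_le adj_simple col0 Delta3 lt_Delta_k eps01 K01 theta_bounds).
Qed.
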